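(* (1) For every $T\in\mathcal{PM}$ there exists a unique $\eta_T\in\mathcal{A}_0(\mathbb{R})^*$ such that $\langle\eta_T,f\star h\rangle=\int_{\mathbb{R}}(Th)(t)f(-t)\,dt$ for all $f\in C_0(\mathbb{R})$ and $h\in H^1(\mathbb{R})$. (2) The map $T\mapsto\eta_T$ is an isometric isomorphism from $\mathcal{PM}$ onto $\mathcal{A}_0(\mathbb{R})^*$ which is a homeomorphism for the respective weak$^*$-topologies.
   Context: $H^1(\mathbb{R})=\{h\in L^1(\mathbb{R}):\widehat h(u)=0\ \forall u\le0\}$, $\widehat h(u)=\int h(t)e^{-itu}dt$; $\tau_sf(t)=f(t-s)$. $\mathcal{A}_0(\mathbb{R})$ is the set of $F\colon\mathbb{R}\to\mathbb{C}$ such that $F=\sum_k f_k\star h_k$ pointwise for some $(f_k)\subset C_0(\mathbb{R})$, $(h_k)\subset H^1(\mathbb{R})$ with $\sum_k\|f_k\|_\infty\|h_k\|_1<\infty$, with norm $\|F\|_{\mathcal{A}_0}$ the infimum of $\sum_k\|f_k\|_\infty\|h_k\|_1$ over such representations (a Banach space). $H^\infty(\mathbb{R})$ is the weak$^*$-closure of $H^1\cap L^\infty$ in $L^\infty(\mathbb{R})$, $Z_0=C_0(\mathbb{R})\cap H^\infty(\mathbb{R})$. $B(H^1(\mathbb{R}))$ is given the weak$^*$-topology from the isometric identification $B(H^1(\mathbb{R}))\simeq\big((C_0(\mathbb{R})/Z_0)\widehat\otimes H^1(\mathbb{R})\big)^*$, $\langle T,\dot f\otimes h\rangle=\int(Th)(t)f(-t)dt$.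 $\mathcal{PM}$ is the weak$^*$-closed linear span of $\{\tau_s|_{H^1(\mathbb{R})}:s\in\mathbb{R}\}$ in $B(H^1(\mathbb{R}))$, with the operator norm. *)

(* Defs.v *)
From mathcomp Require Import all_boot all_order all_algebra.
From mathcomp Require Import all_classical all_reals all_analysis.
From mathcomp.real_closed Require Import complex.
Import GRing.Theory Num.Theory numFieldTopology.Exports numFieldNormedType.Exports.

Set Implicit Arguments.
Unset Strict Implicit.
Unset Printing Implicit Defensive.

Local Open Scope ring_scope.
Local Open Scope classical_set_scope.

Section Defs.
Variable R : realType.
Local Notation C := (R[i]).
Local Notation mu := (@lebesgue_measure R).

Definition cRe (z : C) : R := complex.Re z.
Definition cIm (z : C) : R := complex.Im z.
Definition cmk (a b : R) : C := complex.Complex a b.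
Definition cabs (z : C) : R := Num.sqrt (cRe z ^+ 2 + cIm z ^+ 2).
Definition cexpi (x : R) : C := cmk (cos x) (sin x).

Definition csum (a : nat -> C) : C :=
  cmk (limn (fun n => \sum_(k < n) cRe (a k)))
      (limn (fun n => \sum_(k < n) cIm (a k))).
Definition csum_to (a : nat -> C) (z : C) : Prop :=
  (fun n => \sum_(k < n) cRe (a k)) @ \oo --> cRe z /\
  (fun n => \sum_(k < n) cIm (a k)) @ \oo --> cIm z.

Definition cintegrable (f : R -> C) : Prop :=
  mu.-integrable setT (EFin \o (cRe \o f)) /\
  mu.-integrable setT (EFin \o (cIm \o f)).
Definition cint (f : R -> C) : C :=
  cmk (Rintegral mu setT (cRe \o f)) (Rintegral mu setT (cIm \o f)).
Definition L1norm (f : R -> C) : R := Rintegral mu setT (cabs \o f).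
Definition aeeq (f g : R -> C) : Prop := {ae mu, forall x, f x = g x}.

Definition fourier (h : R -> C) (u : R) : C :=
  cint (fun t => h t * cexpi (- (t * u))).
Definition H1 (h : R -> C) : Prop :=
  cintegrable h /\ forall u : R, u <= 0 -> fourier h u = 0.

Definition C0 (f : R -> C) : Prop :=
  continuous (cRe \o f) /\ continuous (cIm \o f) /\
  forall e : R, 0 < e -> exists M : R, forall t : R, M < `|t| -> cabs (f t) < e.
Definition supnorm (f : R -> C) : R := sup (range (cabs \o f)).

Definition conv (f h : R -> C) (x : R) : C := cint (fun t => f (x - t) * h t).

Definition cost (fs hs : nat -> R -> C) (k : nat) : R :=
  supnorm (fs k) * L1norm (hs k).
Definition admissible (fs hs : nat -> R -> C) : Prop :=
  (forall k, C0 (fs k)) /\ (forall k, H1 (hs k)) /\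
  exists M : R, forall n, \sum_(k < n) cost fs hs k <= M.
Definition total_cost (fs hs : nat -> R -> C) : R :=
  limn (fun n => \sum_(k < n) cost fs hs k).

Definition A0rep (F : R -> C) (fs hs : nat -> R -> C) : Prop :=
  admissible fs hs /\ forall x, csum_to (fun k => conv (fs k) (hs k) x) (F x).
Definition A0 (F : R -> C) : Prop := exists fs hs, A0rep F fs hs.
Definition A0norm (F : R -> C) : R :=
  inf [set c | exists fs hs, A0rep F fs hs /\ c = total_cost fs hs].

Definition dualA0 (eta : (R -> C) -> C) : Prop :=
  (forall (a : C) F G, A0 F -> A0 G ->
     eta (fun x => a * F x + G x) = a * eta F + eta G) /\
  exists M : R, forall F, A0 F -> cabs (eta F) <= M * A0norm F.
Definition dualnorm (eta : (R -> C) -> C) : R :=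
  sup [set cabs (eta F) | F in [set F | A0 F /\ A0norm F <= 1]].

(** B(H^1(R)): operators acting on representatives, respecting a.e.
    equality, linear and bounded on H^1 *)
Definition op := (R -> C) -> (R -> C).
Definition bounded_op (T : op) : Prop :=
  (forall h, H1 h -> H1 (T h)) /\
  (forall h h', H1 h -> H1 h' -> aeeq h h' -> aeeq (T h) (T h')) /\
  (forall (a : C) h h', H1 h -> H1 h' ->
     aeeq (T (fun t => a * h t + h' t)) (fun t => a * T h t + T h' t)) /\
  exists M : R, forall h, H1 h -> L1norm (T h) <= M * L1norm h.
Definition opeq (T T' : op) : Prop := forall h, H1 h -> aeeq (T h) (T' h).
Definition opnorm (T : op) : R :=
  sup [set L1norm (T h) | h in [set h | H1 h /\ L1norm h <= 1]].
Definition opcomb (a : C) (T T' : op) : op :=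
  fun h t => a * T h t + T' h t.

(** duality <T, f (x) h> = \int (Th)(t) f(-t) dt, extended to elements
    sum_k f_k (x) h_k of (C_0/Z_0) \hat(x) H^1 *)
Definition pair (T : op) (f h : R -> C) : C := cint (fun t => T h t * f (- t)).
Definition pairU (T : op) (fs hs : nat -> R -> C) : C :=
  csum (fun k => pair T (fs k) (hs k)).

Definition tau (s : R) : op := fun h t => h (t - s).
Definition span_tau (S : op) : Prop :=
  exists (n : nat) (c : nat -> C) (s : nat -> R),
    S = fun h t => \sum_(j < n) c j * tau (s j) h t.

Definition wstar_closure (P : op -> Prop) (T : op) : Prop :=
  forall (m : nat) (fs hs : nat -> nat -> R -> C) (e : R),
    (forall i, (i < m)%N -> admissible (fs i) (hs i)) -> 0 < e ->
    exists S, P S /\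
      forall i, (i < m)%N -> cabs (pairU T (fs i) (hs i) - pairU S (fs i) (hs i)) < e.

Definition PM (T : op) : Prop := bounded_op T /\ wstar_closure span_tau T.

Definition represents (T : op) (eta : (R -> C) -> C) : Prop :=
  dualA0 eta /\ forall f h, C0 f -> H1 h -> eta (conv f h) = pair T f h.

Definition A0eq (eta eta' : (R -> C) -> C) : Prop := forall F, A0 F -> eta F = eta' F.

End Defs.

(* Main.v *)
Require Import Defs.
From mathcomp Require Import all_boot all_order all_algebra.
From mathcomp Require Import all_classical all_reals all_analysis.
From mathcomp.real_closed Require Import complex.
From mathcomp Require Import measurable_realfun ring lra.
Import Order.TTheory GRing.Theory Num.Theory numFieldTopology.Exports numFieldNormedType.Exports.
Set Implicit Arguments.
Unset Strict Implicit.
Unset Printing Implicit Defensive.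
Local Open Scope ring_scope.
Local Open Scope classical_set_scope.

(** Since [pair (tau s) f h = (f * h)(-s)], an operator [S] in the span of the translations
    pairs with [sum_k f_k (x) h_k] only through the values of [F = sum_k f_k * h_k]. This
    passes to weak-star limits, so [T] in [PM] induces a functional [eta_T] on [A0]; being
    bounded, it satisfies [eta_T F = sum_k pair T f_k h_k] for every representation of [F],
    which makes both weak-star topologies literally the same. The isometry is the duality
    between [C0] and [L^1].

    For surjectivity, fix [eta] and [h] in [H^1]. The functional [Lam f = eta (f * h)] on
    [C0] satisfies [|Lam (tau_s f) - Lam f| <= ||eta|| ||f|| ||tau_s h - h||_1], which tends
    to [0] with [s] uniformly in [f]. Hence the functions [t |-> Lam (tau_{-t} g)], for
    mollifiers [g] of shrinking support, form an [L^1]-Cauchy sequence, and their limit [G]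
    satisfies [Lam f = \int G(t) f(-t) dt]. Neither the Riesz representation theorem nor the
    theorem of F. and M. Riesz is needed. That [G] lies in [H^1] follows by testing against
    [e^{iut} / (1 + i eps t)], [u <= 0], which convolves [h] to zero. Finally the operator
    [h |-> G] is a weak-star limit of combinations of translations because a linear form on
    [A0] agrees on any finite set with a combination of point evaluations. *)

(* The library also exports a [conv], for convex combinations. *)
Local Notation conv := Defs.conv.

(** * Complex numbers and limits *)

(** Membership in [PM] matters because [pairU] is computed from a representation, while a functional
    on [A0] may depend only on the function represented; for an arbitrary bounded operator nothing
    ties the two together.

    For the converse, an arbitrary bounded functional on C_0 need not have a density. Here a
    translation of [f] can be traded for one of [h] without changing [f * h], so continuity of
    translation in L^1, applied to the fixed [h], gives an estimate uniform over the unit ball of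
    C_0. The passage of [Lam] under a convolution integral is obtained by slicing the kernel into
    short pieces.

    The character e^{iut} is not in C_0. Damping it by 1/(1 + i eps t), the average of e^{-i eps s
    t} over s >= 0 with weight e^{-s}, adds only frequencies below [u], where the transform of [h]
    vanishes. The proof replaces this average by a geometric one, which obeys a recursion.

    The last approximation is exact: a combination of given elements of [A0] that vanishes at every
    point is the zero function, so [eta] kills it, and finite-dimensional duality makes [eta] a
    combination of evaluations on their span. *)

Section Modulus.
Context {R : realType}.
Local Notation C := (R[i]).
Implicit Types (z w : C) (a b x y : R).

Lemma cReD z w : cRe (z + w) = cRe z + cRe w. Proof. by case: z w => [? ?] [? ?]. Qed.
Lemma cImD z w : cIm (z + w) = cIm z + cIm w. Proof. by case: z w => [? ?] [? ?]. Qed.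
Lemma cReN z : cRe (- z) = - cRe z. Proof. by case: z. Qed.
Lemma cImN z : cIm (- z) = - cIm z. Proof. by case: z. Qed.
Lemma cReM z w : cRe (z * w) = cRe z * cRe w - cIm z * cIm w.
Proof. by case: z w => [? ?] [? ?]. Qed.
Lemma cImM z w : cIm (z * w) = cRe z * cIm w + cIm z * cRe w.
Proof. by case: z w => [? ?] [? ?] /=; rewrite /cRe /cIm /= addrC. Qed.
Lemma cRe0 : cRe (0 : C) = 0. Proof. by []. Qed.
Lemma cIm0 : cIm (0 : C) = 0. Proof. by []. Qed.
Lemma cRe1 : cRe (1 : C) = 1. Proof. by []. Qed.
Lemma cIm1 : cIm (1 : C) = 0. Proof. by []. Qed.
Lemma cReE a b : cRe (cmk a b) = a. Proof. by []. Qed.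
Lemma cImE a b : cIm (cmk a b) = b. Proof. by []. Qed.

Definition cReImE := (cReD, cImD, cReN, cImN, cReM, cImM, cRe0, cIm0, cRe1, cIm1, cReE, cImE).

Lemma cext z w : cRe z = cRe w -> cIm z = cIm w -> z = w.
Proof. by case: z w => [? ?] [? ?]; rewrite /cRe /cIm /= => -> ->. Qed.

Lemma cRe_sum (I : Type) (r : seq I) (P : pred I) (F : I -> C) :
  cRe (\sum_(i <- r | P i) F i) = \sum_(i <- r | P i) cRe (F i).
Proof. exact: (big_morph _ cReD cRe0). Qed.
Lemma cIm_sum (I : Type) (r : seq I) (P : pred I) (F : I -> C) :
  cIm (\sum_(i <- r | P i) F i) = \sum_(i <- r | P i) cIm (F i).
Proof. exact: (big_morph _ cImD cIm0). Qed.

Lemma cabsE z : `|z| = (cabs z)%:C%C. Proof. exact: normc_def. Qed.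

Lemma cabs_ge0 z : 0 <= cabs z. Proof. exact: sqrtr_ge0. Qed.
Lemma cabs0 : cabs (0 : C) = 0.
Proof. by rewrite /cabs /= expr0n addr0 sqrtr0. Qed.
Lemma cabs0_eq0 z : cabs z = 0 -> z = 0.
Proof. by move=> z0; apply/eqP; rewrite -normr_eq0 cabsE z0. Qed.
Lemma cabsM z w : cabs (z * w) = cabs z * cabs w.
Proof. by apply: (@complexI R); rewrite rmorphM /= -!cabsE normrM. Qed.
Lemma cabsN z : cabs (- z) = cabs z.
Proof. by apply: (@complexI R); rewrite -!cabsE normrN. Qed.
Lemma cabsBC z w : cabs (z - w) = cabs (w - z).
Proof. by rewrite -cabsN opprB. Qed.
Lemma cabsD z w : cabs (z + w) <= cabs z + cabs w.
Proof. by rewrite -lecR rmorphD /= -!cabsE ler_normD. Qed.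
Lemma cabsB z w : cabs (z - w) <= cabs z + cabs w.
Proof. by rewrite (le_trans (cabsD _ _))// cabsN. Qed.
Lemma cabs_sqr z : cabs z ^+ 2 = cRe z ^+ 2 + cIm z ^+ 2.
Proof. by rewrite sqr_sqrtr// addr_ge0 ?sqr_ge0. Qed.
Lemma cabs_real a : cabs (cmk a 0) = `|a|.
Proof. by rewrite /cabs /= expr0n addr0 sqrtr_sqr. Qed.
Lemma cRe_le z : `|cRe z| <= cabs z.
Proof. by rewrite -sqrtr_sqr ler_wsqrtr// lerDl sqr_ge0. Qed.
Lemma cIm_le z : `|cIm z| <= cabs z.
Proof. by rewrite -sqrtr_sqr ler_wsqrtr// lerDr sqr_ge0. Qed.
Lemma cabs_le z : cabs z <= `|cRe z| + `|cIm z|.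
Proof.
have -> : z = cmk (cRe z) 0 + cmk 0 (cIm z).
  by apply: cext; rewrite !cReImE ?addr0 ?add0r.
rewrite (le_trans (cabsD _ _))// cabs_real !cReImE addr0 add0r lerD2l.
by rewrite /cabs /= expr0n add0r sqrtr_sqr.
Qed.
Lemma cabs1 : cabs (1 : C) = 1.
Proof. by rewrite -[1]/(cmk 1 0) cabs_real normr1. Qed.
Lemma cabs_expi x : cabs (cexpi x) = 1.
Proof. by rewrite /cabs /= cos2Dsin2 sqrtr1. Qed.
Lemma cexpiD x y : cexpi (x + y) = cexpi x * cexpi y.
Proof. by apply: cext; rewrite !cReImE ?cosD ?sinD// addrC. Qed.

Lemma cabs_sum (I : Type) (r : seq I) (P : pred I) (F : I -> C) :
  cabs (\sum_(i <- r | P i) F i) <= \sum_(i <- r | P i) cabs (F i).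
Proof.
elim/big_rec2 : _ => [|i y z _ h]; first by rewrite cabs0.
by rewrite (le_trans (cabsD _ _))// lerD2l.
Qed.

Lemma cabs_conj z : cabs (conjc z) = cabs z.
Proof. by case: z => a b; rewrite /cabs /cRe /cIm /= sqrrN. Qed.
Lemma mulc_conj z : z * conjc z = cmk (cabs z ^+ 2) 0.
Proof.
rewrite cabs_sqr; apply: cext; case: z => a b; rewrite !cReImE /cRe /cIm /=; by ring.
Qed.
End Modulus.

Section ComplexLimits.
Context {R : realType}.
Local Notation C := (R[i]).

(** Kept componentwise to match [csum_to]; [ccvgP] gives the equivalent form with the modulus. *)
Definition ccvg (u : nat -> C) (l : C) : Prop :=
  (fun n => cRe (u n)) @ \oo --> cRe l /\ (fun n => cIm (u n)) @ \oo --> cIm l.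

Lemma ccvgP (u : nat -> C) l :
  ccvg u l <-> forall e : R, 0 < e -> exists N, forall n, (N <= n)%N -> cabs (u n - l) < e.
Proof.
split.
- case=> hr hi e e0.
  have e2 : 0 < e / 2 by rewrite divr_gt0.
  move/cvgrPdist_lt : hr => /(_ _ e2)[N1 _ h1].
  move/cvgrPdist_lt : hi => /(_ _ e2)[N2 _ h2].
  exists (maxn N1 N2) => n; rewrite geq_max => /andP[n1 n2].
  rewrite (le_lt_trans (cabs_le _))// !cReImE.
  have /= := h1 n n1; have /= := h2 n n2.
  rewrite distrC => ? ; rewrite distrC => ?.
  by rewrite (splitr e) ltrD.
- move=> h; split; apply/cvgrPdist_lt => e e0; have [N hN] := h e e0;
    exists N => // n /= Nn.
  + rewrite distrC -cReN -cReD; exact: le_lt_trans (cRe_le _) (hN _ Nn).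
  + rewrite distrC -cImN -cImD; exact: le_lt_trans (cIm_le _) (hN _ Nn).
Qed.

Lemma ccvg_squeeze (u : nat -> C) l (b : nat -> R) :
  (forall n, cabs (u n - l) <= b n) -> b @ \oo --> (0 : R) -> ccvg u l.
Proof.
move=> h /cvgrPdist_lt hb; apply/ccvgP => e /hb[N _ hN]; exists N => n Nn.
apply: le_lt_trans (h n) _; have /= := hN n Nn.
by rewrite sub0r normrN; apply: le_lt_trans; rewrite ler_norm.
Qed.

Lemma ccvg_unique (u : nat -> C) l l' : ccvg u l -> ccvg u l' -> l = l'.
Proof.
move=> [h1 h2] [h3 h4]; apply: cext.
  by rewrite -(cvg_lim (@Rhausdorff R) h1) (cvg_lim (@Rhausdorff R) h3).
by rewrite -(cvg_lim (@Rhausdorff R) h2) (cvg_lim (@Rhausdorff R) h4).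
Qed.

Lemma ccvg_ext (u v : nat -> C) l : (forall n, u n = v n) -> ccvg u l -> ccvg v l.
Proof. by move=> /funext ->. Qed.

Lemma ccvg_cst (l : C) : ccvg (fun=> l) l.
Proof. by split; exact: cvg_cst. Qed.

Lemma ccvgD (u v : nat -> C) l m : ccvg u l -> ccvg v m -> ccvg (fun n => u n + v n) (l + m).
Proof.
move=> [h1 h2] [h3 h4]; split; rewrite !cReImE.
  by under eq_fun do rewrite cReImE; exact: cvgD.
by under eq_fun do rewrite cReImE; exact: cvgD.
Qed.

Lemma ccvgZ (a : C) (u : nat -> C) l : ccvg u l -> ccvg (fun n => a * u n) (a * l).
Proof.
move=> [h1 h2]; split; rewrite !cReImE.
  under eq_fun do rewrite cReImE.
  by apply: cvgB; apply: cvgMr.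
under eq_fun do rewrite cReImE.
by apply: cvgD; apply: cvgMr.
Qed.

Lemma ccvg_sum m (u : nat -> nat -> C) (l : nat -> C) :
  (forall j, (j < m)%N -> ccvg (u j) (l j)) ->
  ccvg (fun n => \sum_(j < m) u j n) (\sum_(j < m) l j).
Proof.
elim: m => [|m IH] h.
  rewrite big_ord0; apply: (@ccvg_ext (fun=> 0)); last exact: ccvg_cst.
  by move=> n; rewrite big_ord0.
rewrite big_ord_recr; apply: ccvg_ext; last first.
  by apply: ccvgD; [apply: IH => j jm; apply: h; exact: ltnW | exact: h].
by move=> n; rewrite big_ord_recr.
Qed.

Lemma ccvg_abs_le (u : nat -> C) l M :
  ccvg u l -> (forall n, cabs (u n) <= M) -> cabs l <= M.
Proof.
move=> /ccvgP h hM; apply/ler_addgt0Pr => e /h[N /(_ N (leqnn _)) hN].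
rewrite -(subrK (u N) l) (le_trans (cabsD _ _))// addrC lerD// ltW//.
by rewrite cabsBC.
Qed.

Lemma csum_toE (a : nat -> C) z : csum_to a z <-> ccvg (fun n => \sum_(k < n) a k) z.
Proof.
rewrite /csum_to /ccvg.
by under [in X in _ <-> (X @ _ --> _) /\ _]eq_fun do rewrite cRe_sum;
   under [in X in _ <-> _ /\ (X @ _ --> _)]eq_fun do rewrite cIm_sum.
Qed.

Lemma csum_to_csum (a : nat -> C) z : csum_to a z -> csum a = z.
Proof. by case=> h1 h2; apply: cext; rewrite /csum !cReImE; apply/cvg_lim. Qed.

Lemma bounded_series_cvg (a : nat -> R) (M : R) :
  (forall k, 0 <= a k) -> (forall n, \sum_(k < n) a k <= M) ->
  cvgn (fun n => \sum_(k < n) a k).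
Proof.
move=> a0 aM; apply: nondecreasing_is_cvgn.
  apply/nondecreasing_seqP => n; by rewrite big_ord_recr /= lerDl.
by exists M => _ [n _ <-].
Qed.

(** [csum] is made of [limn], which means nothing for a divergent series; absolute convergence is
    what certifies its value throughout the development. *)
Lemma csum_to_abs (a : nat -> C) (b : nat -> R) (M : R) :
  (forall k, cabs (a k) <= b k) -> (forall n, \sum_(k < n) b k <= M) ->
  csum_to a (csum a).
Proof.
move=> ab bM.
have b0 k : 0 <= b k by exact: le_trans (cabs_ge0 _) (ab k).
suff H (c : nat -> R) : (forall k, `|c k| <= b k) -> cvgn (fun n => \sum_(k < n) c k).
  split; rewrite /csum !cReImE.
    by apply: (H (fun k => cRe (a k))) => k; exact: le_trans (cRe_le _) (ab k).
  by apply: (H (fun k => cIm (a k))) => k; exact: le_trans (cIm_le _) (ab k).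
move=> cb.
have h : (fun n => \sum_(k < n) c k) = series c.
  by apply/funext => n; rewrite /series /= big_mkord.
rewrite h; apply: normed_cvg; apply: (@series_le_cvg _ (fun k => `|c k|) b) => //.
have -> : series b = (fun n => \sum_(k < n) b k).
  by apply/funext => n; rewrite /series /= big_mkord.
exact: bounded_series_cvg b0 bM.
Qed.
End ComplexLimits.

(** * Integration of complex-valued functions *)

Section ComplexIntegral.
Context {R : realType}.
Local Notation C := (R[i]).
Local Notation mu := (@lebesgue_measure R).
Implicit Types (f g h : R -> C) (r : R -> R).

Definition rintegrable r := mu.-integrable setT (EFin \o r).
Definition cmeas f :=
  measurable_fun [set: measurableTypeR R] (@cRe R \o f) /\
  measurable_fun [set: measurableTypeR R] (@cIm R \o f).

Lemma rintegrable_meas r : rintegrable r -> measurable_fun [set: measurableTypeR R] r.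
Proof. by case/integrableP => /measurable_EFinP. Qed.

Lemma rintegrableD r s : rintegrable r -> rintegrable s -> rintegrable (fun t => r t + s t).
Proof. by move=> hr hs; exact: (integrableD measurableT hr hs). Qed.
Lemma rintegrableZ a r : rintegrable r -> rintegrable (fun t => a * r t).
Proof. by move=> hr; exact: (integrableZl measurableT a hr). Qed.
Lemma rintegrableB r s : rintegrable r -> rintegrable s -> rintegrable (fun t => r t - s t).
Proof. by move=> hr hs; exact: (integrableB measurableT hr hs). Qed.
Lemma rintegrable_abs r : rintegrable r -> rintegrable (fun t => `|r t|).
Proof. by move=> hr; exact: (integrable_norm hr). Qed.
Lemma rintegrable_dom r s : measurable_fun [set: measurableTypeR R] r ->
  rintegrable s -> (forall t, `|r t| <= s t) -> rintegrable r.
Proof.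
move=> mr hs rs; apply: le_integrable hs => //; first exact/measurable_EFinP.
by move=> t _ /=; rewrite lee_fin (le_trans (rs t))// ler_norm.
Qed.

Lemma cmeas_cst a : cmeas (fun=> a).
Proof. by split; exact: measurable_cst. Qed.
Lemma cmeasD f g : cmeas f -> cmeas g -> cmeas (fun t => f t + g t).
Proof.
move=> [f1 f2] [g1 g2]; split.
  by rewrite [X in measurable_fun _ X](_ : _ = fun t => cRe (f t) + cRe (g t));
    [exact: measurable_funD | apply/funext => t /=; rewrite cReImE].
by rewrite [X in measurable_fun _ X](_ : _ = fun t => cIm (f t) + cIm (g t));
  [exact: measurable_funD | apply/funext => t /=; rewrite cReImE].
Qed.
Lemma cmeasM f g : cmeas f -> cmeas g -> cmeas (fun t => f t * g t).
Proof.
move=> [f1 f2] [g1 g2]; split.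
  rewrite [X in measurable_fun _ X](_ : _ =
      fun t => cRe (f t) * cRe (g t) - cIm (f t) * cIm (g t)); last first.
    by apply/funext => t /=; rewrite cReImE.
  by apply: measurable_funB; exact: measurable_funM.
rewrite [X in measurable_fun _ X](_ : _ =
    fun t => cRe (f t) * cIm (g t) + cIm (f t) * cRe (g t)); last first.
  by apply/funext => t /=; rewrite cReImE.
by apply: measurable_funD; exact: measurable_funM.
Qed.
Lemma cmeasB f g : cmeas f -> cmeas g -> cmeas (fun t => f t - g t).
Proof.
move=> hf hg; rewrite (_ : (fun t => _) = fun t => f t + (-1) * g t).
  by apply: cmeasD => //; apply: cmeasM => //; exact: cmeas_cst.
by apply/funext => t; rewrite mulN1r.
Qed.
Lemma cmeas_cont f : continuous (@cRe R \o f) -> continuous (@cIm R \o f) -> cmeas f.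
Proof. by move=> h1 h2; split; exact: continuous_measurable_fun. Qed.
Lemma cmeas_comp f (phi : R -> R) : cmeas f -> continuous phi -> cmeas (f \o phi).
Proof.
move=> [h1 h2] /continuous_measurable_fun mp; split.
  exact: (measurableT_comp h1 mp).
exact: (measurableT_comp h2 mp).
Qed.

Lemma measurable_cabs f : cmeas f -> measurable_fun [set: measurableTypeR R] (@cabs R \o f).
Proof.
move=> [h1 h2]; have ms : measurable_fun setT (@Num.sqrt R).
  by apply: continuous_measurable_fun; exact: sqrt_continuous.
apply: (measurableT_comp ms); apply: measurable_funD; exact: measurable_funX.
Qed.

Lemma cintegrable_meas f : cintegrable f -> cmeas f.
Proof. by move=> [h1 h2]; split; exact: rintegrable_meas. Qed.

Lemma cintegrable_abs f : cintegrable f -> rintegrable (@cabs R \o f).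
Proof.
move=> hf; have [h1 h2] := hf.
apply: (@rintegrable_dom _ (fun t => `|cRe (f t)| + `|cIm (f t)|)).
- exact: measurable_cabs (cintegrable_meas hf).
- by apply: rintegrableD; [exact: rintegrable_abs h1|exact: rintegrable_abs h2].
- by move=> t; rewrite ger0_norm ?cabs_ge0// cabs_le.
Qed.

Lemma cintegrable_dom f r : cmeas f -> rintegrable r -> (forall t, cabs (f t) <= r t) ->
  cintegrable f.
Proof.
move=> [h1 h2] hr fr; split; apply: rintegrable_dom hr _ => // t.
  exact: le_trans (cRe_le _) (fr t).
exact: le_trans (cIm_le _) (fr t).
Qed.

Lemma cintegrable0 : cintegrable (fun=> 0 : C).
Proof.
apply: (@cintegrable_dom _ (fun=> 0)); first exact: cmeas_cst.
  exact: integrable0.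
by move=> t; rewrite cabs0.
Qed.

Lemma cintegrableD f g : cintegrable f -> cintegrable g -> cintegrable (fun t => f t + g t).
Proof.
move=> hf hg; apply: (@cintegrable_dom _ (fun t => cabs (f t) + cabs (g t))).
- by apply: cmeasD; exact: cintegrable_meas.
- by apply: rintegrableD; exact: cintegrable_abs.
- by move=> t; exact: cabsD.
Qed.

Lemma cintegrableM f h M : cmeas f -> (forall t, cabs (f t) <= M) -> cintegrable h ->
  cintegrable (fun t => f t * h t).
Proof.
move=> mf fM hh; apply: (@cintegrable_dom _ (fun t => M * cabs (h t))).
- by apply: cmeasM => //; exact: cintegrable_meas.
- by apply: rintegrableZ; exact: cintegrable_abs.
- by move=> t; rewrite cabsM ler_wpM2r ?cabs_ge0.
Qed.

Lemma cintegrableZ a f : cintegrable f -> cintegrable (fun t => a * f t).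
Proof. by apply: (@cintegrableM _ _ (cabs a)) => //; exact: cmeas_cst. Qed.

Lemma cintegrableB f g : cintegrable f -> cintegrable g -> cintegrable (fun t => f t - g t).
Proof.
move=> hf hg; rewrite (_ : (fun t => _) = fun t => f t + (-1) * g t).
  by apply: cintegrableD => //; exact: cintegrableZ.
by apply/funext => t; rewrite mulN1r.
Qed.

Lemma cintD f g : cintegrable f -> cintegrable g ->
  cint (fun t => f t + g t) = cint f + cint g.
Proof.
move=> [f1 f2] [g1 g2]; apply: cext; rewrite /cint !cReImE -RintegralD//.
  by apply: eq_Rintegral => t _ /=; rewrite cReImE.
by apply: eq_Rintegral => t _ /=; rewrite cReImE.
Qed.

Lemma cintZ a f : cintegrable f -> cint (fun t => a * f t) = a * cint f.
Proof.
move=> [f1 f2]; apply: cext; rewrite /cint !cReImE -!RintegralZl//.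
  rewrite -RintegralB//; [|exact: rintegrableZ|exact: rintegrableZ].
  by apply: eq_Rintegral => t _ /=; rewrite cReImE.
rewrite -RintegralD//; [|exact: rintegrableZ|exact: rintegrableZ].
by apply: eq_Rintegral => t _ /=; rewrite cReImE.
Qed.

Lemma cintB f g : cintegrable f -> cintegrable g ->
  cint (fun t => f t - g t) = cint f - cint g.
Proof.
move=> hf hg; rewrite -mulN1r -cintZ// -cintD//; last exact: cintegrableZ.
by congr cint; apply/funext => t; rewrite mulN1r.
Qed.

Lemma cint0 : cint (fun=> 0 : C) = 0.
Proof. by rewrite -[LHS]/(cint (fun=> 0)) /cint /Rintegral !integral0. Qed.

Lemma eq_cint f g : (forall t, f t = g t) -> cint f = cint g.
Proof. by move=> /funext ->. Qed.

Lemma eq_L1norm f g : (forall t, f t = g t) -> L1norm f = L1norm g.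
Proof. by move=> /funext ->. Qed.

Lemma cintegrable_sum n (F : nat -> R -> C) : (forall j, (j < n)%N -> cintegrable (F j)) ->
  cintegrable (fun t => \sum_(j < n) F j t).
Proof.
elim: n => [|n IH] h.
  by under eq_fun do rewrite big_ord0; exact: cintegrable0.
under eq_fun do rewrite big_ord_recr.
apply: cintegrableD; last exact: h.
by apply: IH => j jn; apply: h; exact: ltnW.
Qed.

Lemma cint_sum n (F : nat -> R -> C) : (forall j, (j < n)%N -> cintegrable (F j)) ->
  cint (fun t => \sum_(j < n) F j t) = \sum_(j < n) cint (F j).
Proof.
elim: n => [|n IH] h.
  by under eq_cint do rewrite big_ord0; rewrite big_ord0 cint0.
under eq_cint do rewrite big_ord_recr.
rewrite big_ord_recr /= -IH; last by move=> j jn; apply: h; exact: ltnW.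
rewrite cintD//; last exact: h.
by apply: cintegrable_sum => j jn; apply: h; exact: ltnW.
Qed.

Lemma L1norm_ge0 f : 0 <= L1norm f.
Proof. by apply: Rintegral_ge0 => t _; exact: cabs_ge0. Qed.

Lemma le_L1norm f r : cmeas f -> rintegrable r -> (forall t, cabs (f t) <= r t) ->
  L1norm f <= Rintegral mu setT r.
Proof.
move=> mf hr fr; apply: le_Rintegral => //.
exact/cintegrable_abs/(cintegrable_dom mf hr).
Qed.

Lemma L1normZ a f : cintegrable f -> L1norm (fun t => a * f t) = cabs a * L1norm f.
Proof.
move=> /cintegrable_abs hf; rewrite /L1norm -RintegralZl//.
by apply: eq_Rintegral => t _ /=; rewrite cabsM.
Qed.

Lemma L1normD f g : cintegrable f -> cintegrable g ->
  L1norm (fun t => f t + g t) <= L1norm f + L1norm g.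
Proof.
move=> hf hg; rewrite /L1norm -RintegralD//; [|exact: cintegrable_abs..].
apply: le_L1norm; first exact: cintegrable_meas (cintegrableD hf hg).
  by apply: rintegrableD; exact: cintegrable_abs.
by move=> t; exact: cabsD.
Qed.

Lemma L1normN f : L1norm (fun t => - f t) = L1norm f.
Proof. by apply: eq_Rintegral => t _ /=; rewrite cabsN. Qed.

Lemma L1norm_le_add f g : cintegrable f -> cintegrable g ->
  L1norm f <= L1norm g + L1norm (fun t => f t - g t).
Proof.
move=> hf hg; rewrite -[leLHS](@eq_L1norm (fun t => g t + (f t - g t))); last first.
  by move=> t; rewrite addrC subrK.
by apply: L1normD => //; exact: cintegrableB.
Qed.

(* With [z = cint f], integrate [Re (conj z * f) <= |z| |f|]. *)
Lemma cabs_cint_le f : cintegrable f -> cabs (cint f) <= L1norm f.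
Proof.
move=> hf; set z := cint f.
have [z0|z0] := eqVneq (cabs z) 0; first by rewrite z0 L1norm_ge0.
have zp : 0 < cabs z by rewrite lt0r z0 cabs_ge0.
rewrite -(ler_pM2l zp) -expr2.
have -> : cabs z ^+ 2 = cRe (conjc z * z) by rewrite mulrC mulc_conj cReImE.
rewrite /z -cintZ// -/z.
have hz : cintegrable (fun t => conjc z * f t) by exact: cintegrableZ.
rewrite -[cabs z]cabs_conj -L1normZ//.
apply: le_trans (ler_norm _) _.
rewrite /cint cReImE; apply: le_trans (le_normr_Rintegral _ _) _ => //.
  by case: hz.
apply: le_Rintegral => //.
- by apply: rintegrable_abs; case: hz.
- exact: cintegrable_abs.
- by move=> t _; exact: cRe_le.
Qed.

Lemma ae_imply (P Q : R -> Prop) :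
  {ae mu, forall x, P x} -> (forall x, P x -> Q x) -> {ae mu, forall x, Q x}.
Proof.
by move=> hP PQ; apply: filterS hP; first exact: (ae_filter_ringOfSetsType mu).
Qed.

Lemma aeeq_cint f g : cmeas f -> cmeas g -> aeeq f g -> cint f = cint g.
Proof.
move=> [f1 f2] [g1 g2] fg; apply: cext; rewrite /cint !cReImE.
  congr fine; apply: ae_eq_integral => //; try exact/measurable_EFinP.
  by apply: ae_imply fg _ => t /= ->.
congr fine; apply: ae_eq_integral => //; try exact/measurable_EFinP.
by apply: ae_imply fg _ => t /= ->.
Qed.

Lemma aeeq_L1norm f g : cmeas f -> cmeas g -> aeeq f g -> L1norm f = L1norm g.
Proof.
move=> mf mg fg; congr fine; apply: ae_eq_integral => //.
- by apply/measurable_EFinP; exact: measurable_cabs mf.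
- by apply/measurable_EFinP; exact: measurable_cabs mg.
- by apply: ae_imply fg _ => t /= ->.
Qed.

Lemma L1norm_eq0 f g : cintegrable f -> cintegrable g ->
  L1norm (fun t => f t - g t) = 0 -> aeeq f g.
Proof.
move=> hf hg; have hfg := cintegrableB hf hg; have ha := cintegrable_abs hfg.
move=> h0.
have mm : measurable_fun [set: measurableTypeR R] (EFin \o (@cabs R \o (fun t => f t - g t))).
  by apply/measurable_EFinP; exact: rintegrable_meas ha.
have [h _] := ae_eq_integral_abs mu measurableT mm.
have h1 : ae_eq mu setT (EFin \o (@cabs R \o (fun t => f t - g t))) (cst 0%E).
  apply: h; transitivity (\int[mu]_t (cabs (f t - g t))%:E)%E.
    by apply: eq_integral => t _ /=; rewrite ger0_norm ?cabs_ge0.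
  by rewrite -(fineK (integrable_fin_num measurableT ha)); congr (_%:E); exact: h0.
apply: ae_imply h1 _ => t /= /(_ I) [] /cabs0_eq0 /eqP.
by rewrite subr_eq0 => /eqP.
Qed.

Lemma cint_dominated (F : nat -> R -> C) f r : (forall n, cmeas (F n)) -> cmeas f ->
  rintegrable r -> (forall n t, cabs (F n t) <= r t) ->
  (forall t, ccvg (fun n => F n t) (f t)) -> ccvg (fun n => cint (F n)) (cint f).
Proof.
move=> mF mf hr Fr Ff.
have hF n : cintegrable (F n) by apply: cintegrable_dom hr _.
(* Real and imaginary parts are treated at once, as maps [p] with |p z| <= |z|, to which real
   dominated convergence applies. *)
suff H (p : C -> R) : (forall n, measurable_fun [set: measurableTypeR R] (p \o F n)) ->
   measurable_fun [set: measurableTypeR R] (p \o f) ->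
   (forall z, `|p z| <= cabs z) -> (forall t, (fun n => p (F n t)) @ \oo --> p (f t)) ->
   (fun n => Rintegral mu setT (p \o F n)) @ \oo --> Rintegral mu setT (p \o f).
  split; rewrite /cint /=.
    apply: (H (@cRe R)) => //; first by move=> n; case: (mF n).
    - by case: mf.
    - exact: cRe_le.
    - by move=> t; case: (Ff t).
  apply: (H (@cIm R)) => //; first by move=> n; case: (mF n).
  - by case: mf.
  - exact: cIm_le.
  - by move=> t; case: (Ff t).
move=> mpF mpf pz pF.
have [hi _ hc] := @dominated_convergence _ _ R mu setT measurableT
  (fun n => EFin \o (p \o F n)) (EFin \o (p \o f)) (EFin \o r)
  (fun n => (measurable_EFinP _ _).2 (mpF n)) ((measurable_EFinP _ _).2 mpf)
  ltac:(by apply/aeW => t _ /=; apply/fine_cvgP; split; [exact: nearW|exact: pF]) hr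
  ltac:(by apply/aeW => t n _ /=; rewrite lee_fin (le_trans (pz _))).
apply: fine_cvg; rewrite /Rintegral fineK//.
exact: integrable_fin_num.
Qed.

End ComplexIntegral.

(** * Invariance of the integral; C_0 functions *)

Section MeasurePreserving.
Context {R : realType}.
Local Notation C := (R[i]).
Local Notation mu := (@lebesgue_measure R).
Implicit Types (f g h : R -> C) (phi psi : R -> R).

(** One notion for translations, the reflection at 0 and the maps t |-> x - t, so that the change of
    variables is proved only once; continuity supplies measurability. *)
Definition preserves_mu phi := continuous phi /\
  forall A, measurable A ->
    pushforward mu (phi : measurableTypeR R -> measurableTypeR R) A = mu A.

(** Lebesgue measure is determined by its values on half-open intervals, so it suffices that the
    preimage []a + s, b + s]] has the length of []a, b]]. *)
Lemma preserves_shift s : preserves_mu (fun t => t - s).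
Proof.
have cphi : continuous (fun t : R => t - s).
  by move=> t; apply: cvgB; [exact: cvg_id|exact: cvg_cst].
split=> // A mA.
have mphi : measurable_fun [set: measurableTypeR R] (fun t => t - s : measurableTypeR R).
  exact: continuous_measurable_fun.
apply/esym/lebesgue_measure_unique => //= _ [[a b]] _ <-.
rewrite /pushforward.
have -> : (fun t => t - s) @^-1` `]a, b]%classic = `]a + s, b + s]%classic.
  by apply/seteqP; split => t /=; rewrite !in_itv /= ltrBrDr lerBlDr.
by rewrite !lebesgue_measure_itv /= !lte_fin ltrD2r -!EFinD opprD addrACA subrr addr0.
Qed.

Lemma preserves_opp : preserves_mu (fun t => - t).
Proof.
split; first by move=> t; apply: cvgN; exact: cvg_id.
by move=> A mA; exact: lebesgue_measureN.
Qed.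

Lemma preserves_comp phi psi : preserves_mu phi -> preserves_mu psi ->
  preserves_mu (phi \o psi).
Proof.
move=> [cp hp] [cq hq]; split; first by move=> t; apply: continuous_comp; [exact: cq|exact: cp].
move=> A mA; rewrite -hp// -[RHS]hq//.
rewrite -[X in measurable X]setTI; exact: (continuous_measurable_fun cp).
Qed.

Lemma preserves_reflect x : preserves_mu (fun t => x - t).
Proof.
have -> : (fun t : R => x - t) = (fun t => - t) \o (fun t => t - x).
  by apply/funext => t /=; rewrite opprB.
exact: preserves_comp preserves_opp (preserves_shift x).
Qed.

Section Invariance.
Variable phi : R -> R.
Hypothesis hphi : preserves_mu phi.

Let phi' : measurableTypeR R -> measurableTypeR R := phi.

Let mphi : measurable_fun setT phi'.
Proof. exact: (continuous_measurable_fun hphi.1). Qed.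

Let integral_phi (F : measurableTypeR R -> \bar R) :
  (\int[pushforward mu phi']_x F x = \int[mu]_x F x)%E.
Proof. by apply: eq_measure_integral => A mA _ /=; exact: hphi.2. Qed.

Lemma rintegrable_preserves (r : R -> R) : rintegrable r -> rintegrable (r \o phi).
Proof.
case/integrableP => mr ir; apply/integrableP; split.
  exact: (measurableT_comp mr mphi).
move: ir; rewrite -integral_phi ge0_integral_pushforward//.
exact: measurableT_comp.
Qed.

Lemma Rintegral_preserves (r : R -> R) : rintegrable r ->
  Rintegral mu setT (r \o phi) = Rintegral mu setT r.
Proof.
move=> hr; have [mr _] := integrableP _ _ _ hr; congr fine.
rewrite -[RHS]integral_phi integral_pushforward//.
exact: rintegrable_preserves.
Qed.

Lemma cintegrable_preserves f : cintegrable f -> cintegrable (f \o phi).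
Proof.
by move=> [h1 h2]; split; [exact: rintegrable_preserves h1|exact: rintegrable_preserves h2].
Qed.

Lemma cint_preserves f : cintegrable f -> cint (f \o phi) = cint f.
Proof.
move=> [h1 h2]; apply: cext; rewrite /cint !cReImE.
  by rewrite -(Rintegral_preserves h1).
by rewrite -(Rintegral_preserves h2).
Qed.

Lemma L1norm_preserves f : cintegrable f -> L1norm (f \o phi) = L1norm f.
Proof.
by move=> /cintegrable_abs hf; rewrite /L1norm -(Rintegral_preserves hf).
Qed.
End Invariance.
End MeasurePreserving.

(** * Functions vanishing at infinity: boundedness, sup norm, uniform continuity *)

Section C0Functions.
Context {R : realType}.
Local Notation C := (R[i]).
Implicit Types (f g h : R -> C).

Lemma C0_meas f : C0 f -> cmeas f.
Proof. by move=> [h1 [h2 _]]; exact: cmeas_cont. Qed.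

Lemma continuous_cabs f : continuous (@cRe R \o f) -> continuous (@cIm R \o f) ->
  continuous (@cabs R \o f).
Proof.
move=> h1 h2 t; apply: (@continuous_comp _ _ _ (fun t => cRe (f t) ^+ 2 + cIm (f t) ^+ 2)
  (@Num.sqrt R)); last exact: sqrt_continuous.
by apply: cvgD; rewrite expr2; under eq_fun do rewrite expr2;
  apply: cvgM; solve [exact: h1|exact: h2].
Qed.

Lemma cont_bounded_itv (r : R -> R) (a : R) : continuous r ->
  exists M, forall t, `|t| <= a -> r t <= M.
Proof.
move=> cr; have /compact_bounded[M [_ hM]] : compact (r @` `[- a, a]).
  apply: continuous_compact; last exact: segment_compact.
  by apply: continuous_subspaceT => x; exact: cr.
exists (M + 1) => t ta; apply: le_trans (ler_norm _) _.
by apply: (hM (M + 1)); [rewrite ltrDl|exists t => //=; rewrite in_itv /= -ler_norml].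
Qed.

Lemma C0_bounded f : C0 f -> exists M, forall t, cabs (f t) <= M.
Proof.
move=> [h1 [h2 h3]]; have [A hA] := h3 1 ltr01.
have [M hM] := @cont_bounded_itv (@cabs R \o f) A (continuous_cabs h1 h2).
exists (Num.max M 1) => t; rewrite le_max.
have [tA|At] := leP `|t| A; first by rewrite hM.
by rewrite orbC ltW// hA.
Qed.

Lemma le_supnorm f t : C0 f -> cabs (f t) <= supnorm f.
Proof.
move=> /C0_bounded[M hM]; apply: ub_le_sup; last by exists t.
by exists M => _ [x _ <-]; exact: hM.
Qed.

Lemma supnorm_le f M : (forall t, cabs (f t) <= M) -> supnorm f <= M.
Proof.
move=> fM; apply: ge_sup; first by exists (cabs (f 0)), 0.
by move=> _ [x _ <-]; exact: fM.
Qed.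

Lemma supnorm_ge0 f : C0 f -> 0 <= supnorm f.
Proof. by move=> hf; exact: le_trans (cabs_ge0 _) (le_supnorm 0 hf). Qed.

Lemma C0_0 : C0 (fun=> 0 : C).
Proof.
split; first exact: cst_continuous.
split; first exact: cst_continuous.
by move=> e e0; exists 0 => t _; rewrite cabs0.
Qed.

Lemma supnorm0 : supnorm (fun=> 0 : C) = 0.
Proof.
apply/eqP; rewrite eq_le supnorm_ge0 ?andbT; last exact: C0_0.
by apply: supnorm_le => t; rewrite cabs0.
Qed.

Lemma C0Z a f : C0 f -> C0 (fun t => a * f t).
Proof.
move=> [h1 [h2 h3]]; split; [|split].
- rewrite (_ : _ \o _ = fun t => cRe a * cRe (f t) - cIm a * cIm (f t)).
    by move=> t; apply: cvgB; apply: cvgMr; [exact: h1|exact: h2].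
  by apply/funext => t /=; rewrite cReImE.
- rewrite (_ : _ \o _ = fun t => cRe a * cIm (f t) + cIm a * cRe (f t)).
    by move=> t; apply: cvgD; apply: cvgMr; [exact: h2|exact: h1].
  by apply/funext => t /=; rewrite cReImE.
- move=> e e0; have a0 : 0 < cabs a + 1 by rewrite ltr_wpDl ?cabs_ge0.
  have [M hM] := h3 (e / (cabs a + 1)) (divr_gt0 e0 a0).
  exists M => t /hM; rewrite ltr_pdivlMr// => ht; apply: le_lt_trans ht.
  by rewrite cabsM mulrC ler_wpM2l ?cabs_ge0// lerDl.
Qed.

Lemma C0D f g : C0 f -> C0 g -> C0 (fun t => f t + g t).
Proof.
move=> [h1 [h2 h3]] [g1 [g2 g3]]; split; [|split].
- rewrite (_ : _ \o _ = fun t => cRe (f t) + cRe (g t)).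
    by move=> t; apply: cvgD; [exact: h1|exact: g1].
  by apply/funext => t /=; rewrite cReImE.
- rewrite (_ : _ \o _ = fun t => cIm (f t) + cIm (g t)).
    by move=> t; apply: cvgD; [exact: h2|exact: g2].
  by apply/funext => t /=; rewrite cReImE.
- move=> e e0; have e2 : 0 < e / 2 by rewrite divr_gt0.
  have [M hM] := h3 _ e2; have [N hN] := g3 _ e2.
  exists (Num.max M N) => t; rewrite gt_max => /andP[/hM ht /hN gt].
  by rewrite (le_lt_trans (cabsD _ _))// (splitr e) ltrD.
Qed.

Lemma C0B f g : C0 f -> C0 g -> C0 (fun t => f t - g t).
Proof.
move=> hf hg; under eq_fun do rewrite -mulN1r; apply: C0D => //; exact: C0Z.
Qed.

Lemma C0_shift f s : C0 f -> C0 (fun t => f (t - s)).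
Proof.
have cs : continuous (fun t : R => t - s) := (preserves_shift s).1.
move=> [h1 [h2 h3]]; split; [|split].
- move=> t; apply: (@continuous_comp _ _ _ (fun t => t - s) (@cRe R \o f));
    [exact: cs|exact: h1].
- move=> t; apply: (@continuous_comp _ _ _ (fun t => t - s) (@cIm R \o f));
    [exact: cs|exact: h2].
- move=> e /h3[M hM]; exists (M + `|s|) => t ht; apply: hM.
  by have := lerB_dist t s; lra.
Qed.

Lemma cmeas_reflect f x : cmeas f -> cmeas (fun t => f (x - t)).
Proof. by move=> hf; exact: cmeas_comp hf (preserves_reflect x).1. Qed.

(** Only [t] is confined to the segment, while [t - s] may leave it. The near-covering form of
    compactness is therefore applied to the map (t, s) |-> r (t - s) - r t, which is jointly
    continuous and vanishes at s = 0. *)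
Lemma unif_cont_compact (r : R -> R) (a : R) : continuous r ->
  forall e, 0 < e -> exists2 d, 0 < d &
    forall s t, `|s| < d -> `|t| <= a -> `|r (t - s) - r t| < e.
Proof.
move=> cr e e0.
have /compact_near_coveringP cK := @segment_compact R (- a) a.
have := cK R (nbhs (0 : R)) (fun s t => `|r (t - s) - r t| < e) _ _.
case.
- move=> x _.
  have h0 : (p.1 - p.2) @[p --> (x : R, 0 : R)] --> (x : R).
    have : (p.1 - p.2) @[p --> (x : R, 0 : R)] --> (x - 0 : R).
      by apply: cvgB; [exact: cvg_fst|exact: cvg_snd].
    by rewrite subr0.
  have h : (r (p.1 - p.2) - r p.1) @[p --> (x : R, 0 : R)] --> r x - r x.
    apply: cvgB; first exact: (cvg_comp (fun p : R * R => p.1 - p.2) r h0 (cr x)).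
    by apply: (cvg_comp fst r); [exact: cvg_fst|exact: cr].
  move: h; rewrite subrr => /cvgrPdist_lt /(_ e e0); apply: filterS => -[y s] /=.
  by rewrite sub0r normrN.
- move=> d /= d0 hd; exists d => // s t sd ta; apply: (hd s _ t).
    by rewrite /= sub0r normrN.
  by rewrite /= in_itv /= -ler_norml.
Qed.

Lemma C0_unif_cont f : C0 f -> forall e, 0 < e -> exists2 d, 0 < d &
    forall s t, `|s| < d -> cabs (f (t - s) - f t) < e.
Proof.
move=> [h1 [h2 h3]] e e0; have e2 : 0 < e / 2 by rewrite divr_gt0.
have [M hM] := h3 _ e2.
(* The segment is enlarged by 1 and shifts are kept below 1: if |t| > M + 1, then [t] and [t - s]
   both lie beyond [M], where |f| < e / 2. *)
have [d1 d10 hd1] := unif_cont_compact (M + 1) h1 e2.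
have [d2 d20 hd2] := unif_cont_compact (M + 1) h2 e2.
exists (Num.min 1 (Num.min d1 d2)); first by rewrite !lt_min ltr01 d10 d20.
move=> s t; rewrite !lt_min => /and3P[s1 sd1 sd2].
have [tM|Mt] := leP `|t| (M + 1).
  rewrite (le_lt_trans (cabs_le _))// (splitr e) !cReImE.
  by rewrite ltrD//; [exact: hd1|exact: hd2].
rewrite (le_lt_trans (cabsB _ _))// (splitr e) ltrD// hM//.
  by have := lerB_dist t s; lra.
by lra.
Qed.
End C0Functions.

(** * Convolution and the space A_0 *)

Section Convolution.
Context {R : realType}.
Local Notation C := (R[i]).
Implicit Types (f g h : R -> C) (a : C) (x s : R).

Lemma conv_cintegrable f h x : C0 f -> cintegrable h -> cintegrable (fun t => f (x - t) * h t).
Proof.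
move=> hf; apply: (@cintegrableM _ (fun t => f (x - t)) _ (supnorm f)).
  exact: cmeas_reflect (C0_meas hf).
by move=> t; exact: le_supnorm.
Qed.

Lemma conv_le f h x : C0 f -> cintegrable h -> cabs (conv f h x) <= supnorm f * L1norm h.
Proof.
move=> hf hh; apply: le_trans (cabs_cint_le (conv_cintegrable x hf hh)) _.
have ha := cintegrable_abs hh.
rewrite {2}/L1norm -RintegralZl//; apply: le_L1norm.
- exact: cintegrable_meas (conv_cintegrable x hf hh).
- exact: rintegrableZ ha.
- by move=> t; rewrite cabsM ler_wpM2r ?cabs_ge0 ?le_supnorm.
Qed.

Lemma convDl f g h x : C0 f -> C0 g -> cintegrable h ->
  conv (fun t => f t + g t) h x = conv f h x + conv g h x.
Proof.
move=> hf hg hh; rewrite /conv -cintD; [|exact: conv_cintegrable..].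
by apply: eq_cint => t; rewrite mulrDl.
Qed.

Lemma convZl a f h x : C0 f -> cintegrable h ->
  conv (fun t => a * f t) h x = a * conv f h x.
Proof.
move=> hf hh; rewrite /conv -cintZ; last exact: conv_cintegrable.
by apply: eq_cint => t; rewrite mulrA.
Qed.

Lemma convBl f g h x : C0 f -> C0 g -> cintegrable h ->
  conv (fun t => f t - g t) h x = conv f h x - conv g h x.
Proof.
move=> hf hg hh; rewrite /conv -cintB; [|exact: conv_cintegrable..].
by apply: eq_cint => t; rewrite mulrBl.
Qed.

Lemma convDr f g h x : C0 f -> cintegrable g -> cintegrable h ->
  conv f (fun t => g t + h t) x = conv f g x + conv f h x.
Proof.
move=> hf hg hh; rewrite /conv -cintD; [|exact: conv_cintegrable..].
by apply: eq_cint => t; rewrite mulrDr.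
Qed.

Lemma convBr f g h x : C0 f -> cintegrable g -> cintegrable h ->
  conv f (fun t => g t - h t) x = conv f g x - conv f h x.
Proof.
move=> hf hg hh; rewrite /conv -cintB; [|exact: conv_cintegrable..].
by apply: eq_cint => t; rewrite mulrBr.
Qed.

Lemma convZr a f h x : C0 f -> cintegrable h ->
  conv f (fun t => a * h t) x = a * conv f h x.
Proof.
move=> hf hh; rewrite /conv -cintZ; last exact: conv_cintegrable.
by apply: eq_cint => t; rewrite mulrCA.
Qed.

Lemma conv_shift f h s x : conv (fun t => f (t - s)) h x = conv f h (x - s).
Proof. by apply: eq_cint => t; rewrite addrAC. Qed.

Lemma cintegrable_tau s h : cintegrable h -> cintegrable (tau s h).
Proof. exact: (cintegrable_preserves (preserves_shift s)). Qed.

Lemma L1norm_tau s h : cintegrable h -> L1norm (tau s h) = L1norm h.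
Proof. exact: (L1norm_preserves (preserves_shift s)). Qed.

(** With [conv_shift] this lets a translation pass from [f] to [h]. At x = 0 it is also why pairing
    with [tau s] evaluates [conv f h] at - s. *)
Lemma conv_tau f h s x : C0 f -> cintegrable h -> conv f (tau s h) x = conv f h (x - s).
Proof.
move=> hf hh; rewrite -[RHS](cint_preserves (preserves_shift s)); last first.
  exact: conv_cintegrable.
by apply: eq_cint => t; rewrite /= opprB addrA subrK.
Qed.

Lemma aeeq_conv f g h : C0 f -> cmeas g -> cmeas h -> aeeq g h -> conv f g = conv f h.
Proof.
move=> hf hg hh gh; apply/funext => x; apply: aeeq_cint.
- by apply: cmeasM => //; exact: cmeas_reflect (C0_meas hf).
- by apply: cmeasM => //; exact: cmeas_reflect (C0_meas hf).
- by apply: ae_imply gh _ => t ->.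
Qed.

Lemma pairE (T : op R) f h : pair T f h = conv f (T h) 0.
Proof. by apply: eq_cint => t; rewrite sub0r mulrC. Qed.

Lemma cmeas_expi (u : R) : cmeas (fun t : R => cexpi (- (t * u))).
Proof.
have h : continuous (fun t : R => - (t * u)).
  by move=> t; apply: cvgN; apply: cvgMl; exact: cvg_id.
apply: cmeas_cont => t.
  exact: (@continuous_comp _ _ _ (fun t : R => - (t * u)) (@cos R) t (h t) (@continuous_cos R _)).
exact: (@continuous_comp _ _ _ (fun t : R => - (t * u)) (@sin R) t (h t) (@continuous_sin R _)).
Qed.

Lemma fourier_cintegrable h u : cintegrable h ->
  cintegrable (fun t => h t * cexpi (- (t * u))).
Proof.
move=> hh; under eq_fun do rewrite mulrC.
apply: (@cintegrableM _ (fun t => cexpi (- (t * u))) _ 1) => //; first exact: cmeas_expi.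
by move=> t; rewrite cabs_expi.
Qed.

Lemma H1_cintegrable h : H1 h -> cintegrable h. Proof. by case. Qed.

Lemma H1_0 : H1 (fun=> 0 : C).
Proof.
split; first exact: cintegrable0.
by move=> u _; rewrite /fourier -[RHS]cint0; apply: eq_cint => t; rewrite mul0r.
Qed.

Lemma H1D g h : H1 g -> H1 h -> H1 (fun t => g t + h t).
Proof.
move=> [ig hg] [ih hh]; split; first exact: cintegrableD.
move=> u u0; rewrite /fourier -[RHS]addr0 -{1}(hg u u0) -(hh u u0) -cintD;
  [|exact: fourier_cintegrable..].
by apply: eq_cint => t; rewrite mulrDl.
Qed.

Lemma H1Z a h : H1 h -> H1 (fun t => a * h t).
Proof.
move=> [ih hh]; split; first exact: cintegrableZ.
move=> u u0; rewrite /fourier -[RHS](mulr0 a) -(hh u u0) -cintZ;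
  last exact: fourier_cintegrable.
by apply: eq_cint => t; rewrite mulrA.
Qed.

Lemma H1B g h : H1 g -> H1 h -> H1 (fun t => g t - h t).
Proof. by move=> hg hh; under eq_fun do rewrite -mulN1r; apply: H1D => //; exact: H1Z. Qed.

(** Translation multiplies the Fourier transform by the factor [cexpi (- (s * u))], so its zeros
    persist. *)
Lemma H1_tau s h : H1 h -> H1 (tau s h).
Proof.
move=> [ih hh]; split; first exact: cintegrable_tau.
move=> u u0; rewrite /fourier -[RHS](mulr0 (cexpi (- (s * u)))) -(hh u u0) -cintZ;
  last exact: fourier_cintegrable.
rewrite -[RHS](cint_preserves (preserves_shift s)); last first.
  by apply: cintegrableZ; exact: fourier_cintegrable.
apply: eq_cint => t /=; rewrite /tau mulrCA -cexpiD; congr (_ * cexpi _).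
by rewrite -opprD -mulrDl addrC subrK.
Qed.
End Convolution.

(** * Representations, costs and the norm of A_0 *)

Section A0Space.
Context {R : realType}.
Local Notation C := (R[i]).
Implicit Types (f h F G : R -> C) (fs hs : nat -> R -> C).

Lemma cost_ge0 fs hs k : C0 (fs k) -> 0 <= cost fs hs k.
Proof. by move=> hf; rewrite mulr_ge0 ?L1norm_ge0 ?supnorm_ge0. Qed.

Lemma admissible_conv_csum fs hs x : admissible fs hs ->
  csum_to (fun k => conv (fs k) (hs k) x) (csum (fun k => conv (fs k) (hs k) x)).
Proof.
move=> [hf [hh [M hM]]]; apply: csum_to_abs hM => k.
exact: conv_le (hf k) (H1_cintegrable (hh k)).
Qed.

Lemma admissible_A0rep fs hs : admissible fs hs ->
  A0rep (fun x => csum (fun k => conv (fs k) (hs k) x)) fs hs.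
Proof. by move=> h; split=> // x; exact: admissible_conv_csum. Qed.

Lemma total_cost_cvg fs hs : admissible fs hs ->
  (fun n => \sum_(k < n) cost fs hs k) @ \oo --> total_cost fs hs.
Proof.
move=> [hf [hh [M hM]]].
by apply: (bounded_series_cvg _ hM) => k; exact: cost_ge0.
Qed.

Lemma partial_le_total_cost fs hs n : admissible fs hs ->
  \sum_(k < n) cost fs hs k <= total_cost fs hs.
Proof.
move=> h; have [hf [hh _]] := h.
apply: (@nondecreasing_cvgn_le R (fun n => \sum_(k < n) cost fs hs k)).
  by apply/nondecreasing_seqP => m; rewrite big_ord_recr /= lerDl cost_ge0.
by apply/cvg_ex; exists (total_cost fs hs); exact: total_cost_cvg.
Qed.

Lemma total_cost_le fs hs M : admissible fs hs ->
  (forall n, \sum_(k < n) cost fs hs k <= M) -> total_cost fs hs <= M.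
Proof.
move=> h hM; apply: limr_le; last exact: nearW.
by apply/cvg_ex; exists (total_cost fs hs); exact: total_cost_cvg.
Qed.

Lemma total_cost_ge0 fs hs : admissible fs hs -> 0 <= total_cost fs hs.
Proof. by move=> h; have := partial_le_total_cost 0 h; rewrite big_ord0. Qed.

Lemma A0norm_le F fs hs : A0rep F fs hs -> A0norm F <= total_cost fs hs.
Proof.
move=> h; apply: ge_inf; last by exists fs, hs.
by exists 0 => _ [gs [ks [[had _] ->]]]; exact: total_cost_ge0.
Qed.

Lemma le_A0norm F M : A0 F -> (forall fs hs, A0rep F fs hs -> M <= total_cost fs hs) ->
  M <= A0norm F.
Proof.
move=> [fs [hs h]] hM; apply: lb_le_inf; first by exists (total_cost fs hs), fs, hs.
by move=> _ [gs [ks [hr ->]]]; exact: hM.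
Qed.

Lemma A0norm_ge0 F : A0 F -> 0 <= A0norm F.
Proof. by move=> h; apply: le_A0norm => // fs hs [had _]; exact: total_cost_ge0. Qed.

Lemma le_A0normZ F K x : 0 <= K -> A0 F ->
  (forall fs hs, A0rep F fs hs -> x <= K * total_cost fs hs) -> x <= K * A0norm F.
Proof.
move=> K0 hF h; have [K00|Kn0] := eqVneq K 0.
  by have [fs [hs hr]] := hF; have := h fs hs hr; rewrite K00 !mul0r.
have Kp : 0 < K by rewrite lt0r Kn0.
rewrite mulrC -ler_pdivrMr//; apply: le_A0norm => // fs hs hr.
by rewrite ler_pdivrMr// mulrC h.
Qed.

(** An elementary tensor as a sequence; the zero function lies in both C_0 and H^1, so the same
    padding serves both factors. *)
Definition single f (k : nat) : R -> C := if k is 0 then f else fun=> 0.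

Lemma A0rep_conv f h : C0 f -> H1 h -> A0rep (conv f h) (single f) (single h).
Proof.
move=> hf hh.
have h0 (n : nat) : \sum_(k < n) cost (single f) (single h) k <= cost (single f) (single h) 0.
  case: n => [|n]; first by rewrite big_ord0 cost_ge0.
  rewrite big_ord_recl big1 ?addr0// => i _.
  by rewrite /cost /= supnorm0 mul0r.
split.
  split; first by case=> [|k] //=; exact: C0_0.
  split; first by case=> [|k] //=; exact: H1_0.
  by exists (cost (single f) (single h) 0).
move=> x; apply/csum_toE/ccvgP => e e0; exists 1%N => -[//|n] _.
rewrite big_ord_recl big1 /= ?addr0 ?subrr ?cabs0// => i _.
by rewrite /conv -[RHS]cint0; apply: eq_cint => t; rewrite mul0r.
Qed.

Lemma A0_conv f h : C0 f -> H1 h -> A0 (conv f h).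
Proof. by move=> hf hh; exists (single f), (single h); exact: A0rep_conv. Qed.

Lemma A0norm_conv f h : C0 f -> H1 h -> A0norm (conv f h) <= supnorm f * L1norm h.
Proof.
move=> hf hh; have hr := A0rep_conv hf hh.
apply: le_trans (A0norm_le hr) _; apply: total_cost_le hr.1 _ => -[|n].
  by rewrite big_ord0 mulr_ge0 ?L1norm_ge0 ?supnorm_ge0.
by rewrite big_ord_recl big1 ?addr0// => i _; rewrite /cost /= supnorm0 mul0r.
Qed.

(** The sum of two elements of [A0] needs a single sequence of tensors, so two infinite
    representations are merged by alternating their terms. *)
Definition interleave (T : Type) (c d : nat -> T) (k : nat) : T :=
  if odd k then d k./2 else c k./2.

Lemma sum_interleave (V : nmodType) (c d : nat -> V) n :
  \sum_(k < n) interleave c d k = \sum_(k < uphalf n) c k + \sum_(k < n./2) d k.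
Proof.
elim: n => [|n IH]; first by rewrite !big_ord0 addr0.
rewrite big_ord_recr /= IH /interleave uphalf_half; case: (odd n) => /=.
  by rewrite add1n !big_ord_recr /= !addrA.
by rewrite add0n big_ord_recr /= addrAC.
Qed.

(** This growth condition on [k] covers both index maps of [sum_interleave], [uphalf] and [half]. *)
Lemma ccvg_subseq (u : nat -> C) l (k : nat -> nat) : (forall n, (n./2 <= k n)%N) ->
  ccvg u l -> ccvg (fun n => u (k n)) l.
Proof.
move=> hk /ccvgP h; apply/ccvgP => e /h[N hN]; exists N.*2 => n Nn; apply: hN.
by apply: leq_trans (hk n); rewrite -(doubleK N) half_leq.
Qed.

Lemma A0_lin a F G : A0 F -> A0 G -> A0 (fun x => a * F x + G x).
Proof.
move=> [fs [hs [[hf [hh [M hM]]] hF]]] [gs [ks [[hg [hk [N hN]]] hG]]].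
(* The scalar is absorbed into the C_0 factors, which multiplies each cost by at most |a|. *)
pose as_ k t := a * fs k t.
have ha k : C0 (as_ k) by exact: C0Z.
have costE k : cost (interleave as_ gs) (interleave hs ks) k =
    interleave (cost as_ hs) (cost gs ks) k.
  by rewrite /cost /interleave; case: odd.
have sa k : supnorm (as_ k) <= cabs a * supnorm (fs k).
  by apply: supnorm_le => t; rewrite cabsM ler_wpM2l ?cabs_ge0 ?le_supnorm.
exists (interleave as_ gs), (interleave hs ks); split.
  split; first by move=> k; rewrite /interleave; case: odd.
  split; first by move=> k; rewrite /interleave; case: odd.
  exists (cabs a * M + N) => n; under eq_bigr do rewrite costE.
  rewrite sum_interleave lerD//; apply: (@le_trans _ _ (\sum_(k < uphalf n) cabs a * cost fs hs k)).
    by apply: ler_sum => k _; rewrite mulrA ler_wpM2r ?L1norm_ge0.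
  by rewrite -mulr_sumr ler_wpM2l ?cabs_ge0.
move=> x; apply/csum_toE.
apply: (@ccvg_ext _ (fun n => a * \sum_(k < uphalf n) conv (fs k) (hs k) x +
    \sum_(k < n./2) conv (gs k) (ks k) x)).
  move=> n; rewrite mulr_sumr -(sum_interleave (fun k => a * conv (fs k) (hs k) x)
     (fun k => conv (gs k) (ks k) x)).
  apply: eq_bigr => k _; rewrite /interleave; case: odd => //.
  by rewrite convZl//; exact: H1_cintegrable.
apply: ccvgD.
  apply: ccvgZ; apply: (@ccvg_subseq (fun n => \sum_(k < n) conv (fs k) (hs k) x)).
    by move=> n; rewrite uphalf_half leq_addl.
  exact: (@csum_toE _ _ _).1 (hF x).
apply: (@ccvg_subseq (fun n => \sum_(k < n) conv (gs k) (ks k) x)) => //.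
exact: (@csum_toE _ _ _).1 (hG x).
Qed.

Lemma A0_0 : A0 (fun=> 0 : C).
Proof.
have := A0_conv C0_0 H1_0; congr A0; apply/funext => x.
by rewrite -[RHS]cint0; apply: eq_cint => t; rewrite mul0r.
Qed.

Lemma A0_sum n (Fs : nat -> R -> C) (c : nat -> C) : (forall i, (i < n)%N -> A0 (Fs i)) ->
  A0 (fun x => \sum_(i < n) c i * Fs i x).
Proof.
elim: n => [|n IH] h.
  by under eq_fun do rewrite big_ord0; exact: A0_0.
under eq_fun do rewrite big_ord_recr /= addrC.
by apply: A0_lin; [exact: h|apply: IH => i ni; apply: h; exact: ltnW].
Qed.

(** This is convergence of the partial sums to [F] in the norm of A_0: the shifted sequences
    represent the remainder, at a cost bounded by the tail of a convergent series. *)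
Lemma A0rep_tail F fs hs n : A0rep F fs hs ->
  A0rep (fun x => F x - \sum_(k < n) conv (fs k) (hs k) x)
    (fun k => fs (n + k)%N) (fun k => hs (n + k)%N) /\
  total_cost (fun k => fs (n + k)%N) (fun k => hs (n + k)%N) <=
    total_cost fs hs - \sum_(k < n) cost fs hs k.
Proof.
move=> [had hF]; have [hf [hh [M hM]]] := had.
have hc m : \sum_(k < m) cost (fun k => fs (n + k)%N) (fun k => hs (n + k)%N) k <=
    total_cost fs hs - \sum_(k < n) cost fs hs k.
  rewrite lerBrDl; apply: le_trans (partial_le_total_cost (n + m) had).
  by rewrite big_split_ord.
have ha : admissible (fun k => fs (n + k)%N) (fun k => hs (n + k)%N).
  by split=> //; split=> //; exists (total_cost fs hs - \sum_(k < n) cost fs hs k).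
split; last exact: total_cost_le.
split=> // x; apply/csum_toE/ccvgP => e e0.
have /csum_toE/ccvgP/(_ _ e0)[N hN] := hF x.
exists N => m Nm; have := hN (n + m)%N (leq_trans Nm (leq_addl _ _)).
rewrite big_split_ord /= => h.
by rewrite opprB addrA [X in cabs (X - _)]addrC.
Qed.
End A0Space.

(** * Bounded functionals on A_0 *)

Section DualA0.
Context {R : realType}.
Local Notation C := (R[i]).
Variable eta : (R -> C) -> C.
Hypothesis heta : dualA0 eta.
Implicit Types (F G : R -> C) (fs hs : nat -> R -> C).

Lemma dualA0_0 : eta (fun=> 0) = 0.
Proof.
have := heta.1 1 (fun=> 0) (fun=> 0) A0_0 A0_0.
rewrite (_ : (fun x => _) = fun=> 0); last by apply/funext => x; rewrite mulr0 addr0.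
by rewrite mul1r => h; apply: (addrI (eta (fun=> 0))); rewrite addr0 -h.
Qed.

Lemma dualA0B F G : A0 F -> A0 G -> eta (fun x => F x - G x) = eta F - eta G.
Proof.
move=> hF hG; rewrite addrC -mulN1r -(heta.1 _ _ _ hG hF).
by congr eta; apply/funext => x; rewrite mulN1r addrC.
Qed.

Lemma dualA0_sum n (Fs : nat -> R -> C) (c : nat -> C) : (forall i, (i < n)%N -> A0 (Fs i)) ->
  eta (fun x => \sum_(i < n) c i * Fs i x) = \sum_(i < n) c i * eta (Fs i).
Proof.
elim: n => [|n IH] h.
  rewrite big_ord0 -[RHS]dualA0_0; congr eta; apply/funext => x; by rewrite big_ord0.
rewrite big_ord_recr /= addrC -IH; last by move=> i ni; apply: h; exact: ltnW.
rewrite -(heta.1 _ _ _ (h n (ltnSn n))).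
  by congr eta; apply/funext => x; rewrite big_ord_recr addrC.
by apply: A0_sum => i ni; apply: h; exact: ltnW.
Qed.

Lemma dualA0_bound : exists2 M : R, 0 <= M & forall F, A0 F -> cabs (eta F) <= M * A0norm F.
Proof.
have [_ [M hM]] := heta; exists (Num.max M 0); first by rewrite le_max lexx orbT.
move=> F hF; apply: le_trans (hM F hF) _.
by rewrite ler_wpM2r ?A0norm_ge0// le_max lexx.
Qed.

(** The error after [n] terms is [eta] of the remainder, at most [M] times the tail of the costs.
    Hence [eta] is determined on [A0] by its values on convolutions, which is the uniqueness of
    eta_T. *)
Lemma dualA0_csum F fs hs : A0rep F fs hs ->
  csum_to (fun k => eta (conv (fs k) (hs k))) (eta F).
Proof.
move=> hr; have [M M0 hM] := dualA0_bound.
have [[hf [hh _]] _] := hr.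
have hA k : A0 (conv (fs k) (hs k)) by exact: A0_conv.
have hF : A0 F by exists fs, hs.
apply/csum_toE.
apply: (@ccvg_squeeze _ _ _ (fun n => M * (total_cost fs hs - \sum_(k < n) cost fs hs k))).
  move=> n; have [ht hc] := A0rep_tail n hr.
  have := hM _ (ex_intro _ _ (ex_intro _ _ ht)).
  have hs1 : A0 (fun x => \sum_(k < n) conv (fs k) (hs k) x).
    have := @A0_sum R n (fun k => conv (fs k) (hs k)) (fun=> 1) (fun i _ => hA i).
    by under eq_fun do under eq_bigr do rewrite mul1r.
  rewrite dualA0B//.
  have -> : eta (fun x => \sum_(k < n) conv (fs k) (hs k) x) =
      \sum_(k < n) eta (conv (fs k) (hs k)).
    have := @dualA0_sum n (fun k => conv (fs k) (hs k)) (fun=> 1) (fun i _ => hA i).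
    under eq_bigr do rewrite mul1r; move=> <-.
    by congr eta; apply/funext => x; apply: eq_bigr => i _; rewrite mul1r.
  rewrite cabsBC => h; apply: le_trans h _; rewrite ler_wpM2l//.
  exact: le_trans (A0norm_le ht) hc.
have : (fun n => M * (total_cost fs hs - \sum_(k < n) cost fs hs k)) @ \oo -->
    M * (total_cost fs hs - total_cost fs hs).
  by apply: cvgMr; apply: cvgB; [exact: cvg_cst|exact: total_cost_cvg hr.1].
by rewrite subrr mulr0.
Qed.
End DualA0.

(** * Operators and the functionals they induce *)

Section Operators.
Context {R : realType}.
Local Notation C := (R[i]).
Implicit Types (T S : op R) (f h F G : R -> C) (fs hs : nat -> R -> C).

Lemma pair_le T f h : C0 f -> cintegrable (T h) -> cabs (pair T f h) <= supnorm f * L1norm (T h).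
Proof. by move=> hf hT; rewrite pairE; exact: conv_le. Qed.

Lemma bounded_op_bound T : bounded_op T ->
  exists2 M : R, 0 <= M & forall h, H1 h -> L1norm (T h) <= M * L1norm h.
Proof.
move=> [_ [_ [_ [M hM]]]]; exists (Num.max M 0); first by rewrite le_max lexx orbT.
move=> h /hM hh; apply: le_trans hh _.
by rewrite ler_wpM2r ?L1norm_ge0// le_max lexx.
Qed.

(** Each term is at most |f_k| |T h_k| <= K |f_k| |h_k| in the respective norms. With [K] the
    operator norm this gives half of the isometry. *)
Lemma pairU_csum T fs hs K : bounded_op T -> (forall h, H1 h -> L1norm (T h) <= K * L1norm h) ->
  0 <= K -> admissible fs hs ->
  csum_to (fun k => pair T (fs k) (hs k)) (pairU T fs hs) /\
  cabs (pairU T fs hs) <= K * total_cost fs hs.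
Proof.
move=> bT hK K0 had; have [hf [hh _]] := had.
have hb k : cabs (pair T (fs k) (hs k)) <= K * cost fs hs k.
  apply: le_trans (pair_le (hf k) (H1_cintegrable (bT.1 _ (hh k)))) _.
  by rewrite /cost mulrCA ler_wpM2l ?supnorm_ge0// hK.
have hs1 n : \sum_(k < n) K * cost fs hs k <= K * total_cost fs hs.
  by rewrite -mulr_sumr ler_wpM2l// partial_le_total_cost.
have h := csum_to_abs hb hs1; split=> //.
apply: ccvg_abs_le ((@csum_toE _ _ _).1 h) _ => n.
apply: le_trans (cabs_sum _ _ _) _; apply: le_trans (hs1 n).
by apply: ler_sum => k _.
Qed.

Lemma pair_span n (c : nat -> C) (s : nat -> R) f h : C0 f -> cintegrable h ->
  pair (fun h t => \sum_(j < n) c j * tau (s j) h t) f h =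
  \sum_(j < n) c j * conv f h (- s j).
Proof.
move=> hf hh.
have hi j : cintegrable (fun t => f (0 - t) * tau (s j) h t).
  by apply: conv_cintegrable => //; exact: cintegrable_tau.
transitivity (cint (fun t => \sum_(j < n) c j * (f (0 - t) * tau (s j) h t))).
  apply: eq_cint => t; rewrite mulr_suml; apply: eq_bigr => j _.
  by rewrite sub0r -mulrA [_ * f _]mulrC.
rewrite (@cint_sum _ n (fun j t => c j * (f (0 - t) * tau (s j) h t))); last first.
  by move=> j _; exact: cintegrableZ.
by apply: eq_bigr => j _; rewrite cintZ// -/(conv f (tau (s j) h) 0) conv_tau// sub0r.
Qed.

(** The finite sum over translations commutes with the limit over [k]; what remains on the right no
    longer mentions the representation. *)
Lemma pairU_span n (c : nat -> C) (s : nat -> R) F fs hs : A0rep F fs hs ->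
  pairU (fun h t => \sum_(j < n) c j * tau (s j) h t) fs hs = \sum_(j < n) c j * F (- s j).
Proof.
move=> [[hf [hh _]] hF]; apply: csum_to_csum; apply/csum_toE.
apply: (@ccvg_ext _ (fun m => \sum_(j < n) c j * \sum_(k < m) conv (fs k) (hs k) (- s j))).
  move=> m; under eq_bigr do rewrite mulr_sumr; rewrite exchange_big.
  by apply: eq_bigr => k _; rewrite pair_span//; exact: H1_cintegrable.
apply: (@ccvg_sum _ n (fun j m => c j * \sum_(k < m) conv (fs k) (hs k) (- s j))
  (fun j => c j * F (- s j))) => j _.
by apply: ccvgZ; exact: (@csum_toE _ _ _).1 (hF _).
Qed.

(* Elements of [span_tau] pair with [sum_k fs k (x) hs k] through the values of
   [F = sum_k fs k * hs k] only; weak-star limits inherit this. *)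
Lemma wstar_pairU_lin T a F G fs hs gs ks ps qs : wstar_closure (@span_tau R) T ->
  A0rep F fs hs -> A0rep G gs ks -> A0rep (fun x => a * F x + G x) ps qs ->
  pairU T ps qs = a * pairU T fs hs + pairU T gs ks.
Proof.
move=> hT hF hG hP.
apply/eqP; rewrite -subr_eq0; apply/eqP/cabs0_eq0/eqP; rewrite eq_le cabs_ge0 andbT.
apply/ler_addgt0Pr => e e0; rewrite add0r.
(* The three approximation errors enter with weights |a|, 1 and 1. *)
have a0 : 0 < cabs a + 2 by rewrite ltr_wpDl ?cabs_ge0.
have d0 : 0 < e / (cabs a + 2) by rewrite divr_gt0.
(* The three representations form one weak-star neighbourhood, so a single combination of
   translations approximates [T] on all of them. *)
pose FS (i : nat) := if i is 0 then fs else if i is 1 then gs else ps.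
pose HS (i : nat) := if i is 0 then hs else if i is 1 then ks else qs.
have [|S [[n [c [s ->]]] hS]] := hT 3%N FS HS _ _ d0.
  by move=> [|[|[|//]]] _; [exact: hF.1|exact: hG.1|exact: hP.1].
have /= h0 := hS 0%N isT; have /= h1 := hS 1%N isT; have /= h2 := hS 2%N isT.
move: h0 h1 h2; rewrite (pairU_span _ _ _ hF) (pairU_span _ _ _ hG) (pairU_span _ _ _ hP).
set x := pairU T fs hs; set y := pairU T gs ks; set z := pairU T ps qs.
set X := \sum_(j < n) c j * F _; set Y := \sum_(j < n) c j * G _.
have -> : \sum_(j < n) c j * (a * F (- s j) + G (- s j)) = a * X + Y.
  by rewrite mulr_sumr -big_split /=; apply: eq_bigr => j _; rewrite mulrDr mulrCA.
move=> hx hy hz.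
have -> : z - (a * x + y) = (z - (a * X + Y)) - (a * (x - X) + (y - Y)) by ring.
apply: le_trans (cabsB _ _) _; apply: le_trans (lerD (lexx _) (cabsD _ _)) _.
rewrite cabsM.
have -> : e = e / (cabs a + 2) + (cabs a * (e / (cabs a + 2)) + e / (cabs a + 2)).
  by field; rewrite gt_eqF.
apply: lerD; first exact: ltW.
apply: lerD; last exact: ltW.
by apply: ler_wpM2l; [exact: cabs_ge0|exact: ltW].
Qed.

Lemma wstar_pairU_unique T F fs hs gs ks : wstar_closure (@span_tau R) T ->
  A0rep F fs hs -> A0rep F gs ks -> pairU T fs hs = pairU T gs ks.
Proof.
move=> hT h1 h2; have := @wstar_pairU_lin T 0 F F gs ks gs ks fs hs hT h2 h2.
rewrite mul0r add0r; apply; rewrite (_ : (fun x => _) = F)//.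
by apply/funext => x; rewrite mul0r add0r.
Qed.

(** A representation is chosen for each [F] in [A0]; the value 0 elsewhere is arbitrary, since
    [dualA0] only looks at [A0]. *)
Definition functional_of T F : C :=
  if pselect (A0 F) is left p then pairU T (projT1 (cid p)) (projT1 (cid (projT2 (cid p)))) else 0.

Lemma functional_ofE T F fs hs : wstar_closure (@span_tau R) T ->
  A0rep F fs hs -> functional_of T F = pairU T fs hs.
Proof.
move=> hT hr; rewrite /functional_of; case: pselect => [p|]; last by case; exists fs, hs.
apply: wstar_pairU_unique hT _ hr; exact: (projT2 (cid (projT2 (cid p)))).
Qed.

Lemma functional_of_dual T : PM T -> dualA0 (functional_of T).
Proof.
move=> [bT hT]; split.
  move=> a F G hF hG; have [fs [hs hr]] := hF; have [gs [ks hr']] := hG.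
  have [ps [qs hp]] := A0_lin a hF hG.
  rewrite (functional_ofE hT hr) (functional_ofE hT hr') (functional_ofE hT hp).
  exact: (wstar_pairU_lin hT hr hr' hp).
have [M M0 hM] := bounded_op_bound bT; exists M => F hF.
apply: le_A0normZ => // fs hs hr; rewrite (functional_ofE hT hr).
by have [] := pairU_csum bT hM M0 hr.1.
Qed.

Lemma functional_of_represents T : PM T -> represents T (functional_of T).
Proof.
move=> hT; split; first exact: functional_of_dual.
move=> f h hf hh; rewrite (functional_ofE hT.2 (A0rep_conv hf hh)).
apply: csum_to_csum; apply/csum_toE/ccvgP => e e0; exists 1%N => -[//|n] _.
rewrite big_ord_recl big1 /= ?addr0 ?subrr ?cabs0// => i _.
by rewrite pairE /conv -[RHS]cint0; apply: eq_cint => t; rewrite mul0r.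
Qed.

Lemma represents_pairU T eta F fs hs : represents T eta -> A0rep F fs hs ->
  eta F = pairU T fs hs.
Proof.
move=> [hd he] hr; have [[hf [hh _]] _] := hr.
apply/esym/csum_to_csum; have := dualA0_csum hd hr.
by under [in X in X -> _]eq_fun do rewrite he//.
Qed.

Lemma represents_opcomb a T T' eta eta' : bounded_op T -> bounded_op T' ->
  represents T eta -> represents T' eta' ->
  represents (opcomb a T T') (fun F => a * eta F + eta' F).
Proof.
move=> bT bT' [hd he] [hd' he']; split.
  split.
    by move=> b F G hF hG; rewrite hd.1// hd'.1//; ring.
  have [M M0 hM] := dualA0_bound hd; have [N N0 hN] := dualA0_bound hd'.
  exists (cabs a * M + N) => F hF; apply: le_trans (cabsD _ _) _.
  rewrite cabsM mulrDl -mulrA lerD ?hN// ler_wpM2l ?cabs_ge0 ?hM//.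
move=> f h hf hh; rewrite he// he'// !pairE.
have iT := H1_cintegrable (bT.1 _ hh); have iT' := H1_cintegrable (bT'.1 _ hh).
rewrite -convZr// -convDr//; exact: cintegrableZ.
Qed.

Lemma le_opnorm T h : bounded_op T -> H1 h -> L1norm (T h) <= opnorm T * L1norm h.
Proof.
move=> bT hh; have [M M0 hM] := bounded_op_bound bT.
have [hT [hae [hlin _]]] := bT.
(* A null function cannot be normalised; the bound by [M] settles that case. *)
have [h0|hn0] := eqVneq (L1norm h) 0.
  by rewrite h0 mulr0; have := hM h hh; rewrite h0 mulr0.
have hp : 0 < L1norm h by rewrite lt0r hn0 L1norm_ge0.
pose c : C := cmk (L1norm h)^-1 0.
have cc : cabs c = (L1norm h)^-1 by rewrite cabs_real ger0_norm// invr_ge0 ltW.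
have hch : H1 (fun t => c * h t) by exact: H1Z.
have nT : L1norm (T (fun t => c * h t)) = cabs c * L1norm (T h).
  rewrite -L1normZ; last exact: H1_cintegrable (hT _ hh).
  apply: aeeq_L1norm.
  - exact: cintegrable_meas (H1_cintegrable (hT _ hch)).
  - by apply: cintegrable_meas; apply: cintegrableZ; exact: H1_cintegrable (hT _ hh).
  (* Homogeneity is extracted from linearity in the form a * h + h' by writing c h as (c - 1) h +
     h. *)
  - have := hlin (c - 1) h h hh hh.
    rewrite (_ : (fun t => (c - 1) * h t + h t) = fun t => c * h t); last first.
      by apply/funext => t; ring.
    by move=> H; apply: ae_imply H _ => t ->; ring.
rewrite -ler_pdivrMr// mulrC -cc -nT; apply: ub_le_sup.
  exists M => _ [k [hk k1] <-]; apply: le_trans (hM _ hk) _.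
  by rewrite -[leRHS]mulr1 ler_wpM2l.
exists (fun t => c * h t) => //; split=> //.
by rewrite L1normZ ?cc ?mulVf//; exact: H1_cintegrable.
Qed.

Lemma opnorm_ge0 T : bounded_op T -> 0 <= opnorm T.
Proof.
move=> bT; have [M M0 hM] := bounded_op_bound bT.
apply: le_trans (L1norm_ge0 (T (fun=> 0))) _; apply: ub_le_sup.
  exists M => _ [k [hk k1] <-]; apply: le_trans (hM _ hk) _.
  by rewrite -[leRHS]mulr1 ler_wpM2l.
exists (fun=> 0) => //; split; first exact: H1_0.
by rewrite /L1norm /Rintegral (eq_integral (cst 0%E)) ?integral0// => t _ /=; rewrite cabs0.
Qed.

Lemma dualnorm_le_opnorm T eta : PM T -> represents T eta -> dualnorm eta <= opnorm T.
Proof.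
move=> hT he; have o0 := opnorm_ge0 hT.1.
apply: ge_sup.
  exists (cabs (eta (fun=> 0))), (fun=> 0) => //; split; first exact: A0_0.
  have := A0norm_conv (@C0_0 R) H1_0; rewrite supnorm0 mul0r.
  rewrite (_ : conv _ _ = fun=> 0).
    by move/le_trans; apply.
  by apply/funext => x; rewrite -[RHS]cint0; apply: eq_cint => t; rewrite mul0r.
move=> _ [F [hF F1] <-]; apply: (@le_trans _ _ (opnorm T * A0norm F)); last first.
  by rewrite -[leRHS]mulr1 ler_wpM2l.
apply: le_A0normZ => // fs hs hr; rewrite (represents_pairU he hr).
by have [] := pairU_csum hT.1 (fun h => le_opnorm hT.1) o0 hr.1.
Qed.

Lemma le_dualnorm eta F : dualA0 eta -> A0 F -> A0norm F <= 1 -> cabs (eta F) <= dualnorm eta.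
Proof.
move=> hd hF F1; have [M M0 hM] := dualA0_bound hd; apply: ub_le_sup; last by exists F.
exists M => _ [G [hG G1] <-]; apply: le_trans (hM _ hG) _.
by rewrite -[leRHS]mulr1 ler_wpM2l.
Qed.
End Operators.

(** * Completeness of L^1 *)

Section L1Space.
Context {R : realType}.
Local Notation C := (R[i]).
Local Notation mu := (@lebesgue_measure R).
Implicit Types (f g h : R -> C) (r : R -> R).

Lemma rintegral_finE r : rintegrable r -> (\int[mu]_x (r x)%:E)%E = (Rintegral mu setT r)%:E.
Proof. by move=> hr; rewrite /Rintegral fineK//; exact: integrable_fin_num. Qed.

(** By monotone convergence the extended-real limit has integral at most [K], so it is finite almost
    everywhere. Taking [fine] makes it a real function, which may fail to dominate only on the null
    set where the limit is infinite. *)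
Lemma monotone_dominated (r : nat -> R -> R) (K : R) : (forall n, rintegrable (r n)) ->
  (forall n t, 0 <= r n t) -> (forall t, nondecreasing_seq (r^~ t)) ->
  (forall n, Rintegral mu setT (r n) <= K) ->
  exists2 s : R -> R, rintegrable s &
    Rintegral mu setT s <= K /\ {ae mu, forall t, forall n, r n t <= s t}.
Proof.
move=> ir r0 rnd rK.
pose e n (t : measurableTypeR R) := (r n t)%:E.
have me n : measurable_fun setT (e n).
  by apply/measurable_EFinP; exact: rintegrable_meas.
have e0 n t : setT t -> (0 <= e n t)%E by rewrite lee_fin.
have end_ t : setT t -> nondecreasing_seq (e ^~ t).
  by move=> _ m n mn; rewrite lee_fin rnd.
pose s t := limn (e ^~ t).
have cs t : cvgn (e ^~ t) by apply: ereal_nondecreasing_is_cvgn; exact: end_.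
have s0 t : (0 <= s t)%E by apply: lime_ge => //; apply: nearW => n; exact: e0.
have le_s n t : (e n t <= s t)%E.
  apply: lime_ge => //; exists n => // m /= nm; exact: (end_ t I n m nm).
have ms : measurable_fun setT s by apply: (emeasurable_fun_cvg e) => // t _; exact: cs.
have isK : (\int[mu]_t s t <= K%:E)%E.
  rewrite (monotone_convergence mu measurableT me e0 end_); apply: lime_le.
    apply: ereal_nondecreasing_is_cvgn => m n mn; apply: ge0_le_integral => //.
      by move=> t _; exact: e0.
    by move=> t _; exact: (end_ t I m n mn).
  by apply: nearW => n; rewrite rintegral_finE// lee_fin.
have is_ : mu.-integrable setT s.
  apply/integrableP; split => //.
  under eq_integral do rewrite gee0_abs//.
  by apply: le_lt_trans isK _; rewrite ltry.
have mf : measurable_fun setT (fine \o s) by exact: measurableT_comp.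
have fs t : ((fine (s t))%:E <= s t)%E.
  by move: (s0 t); case: (s t) => //= ?; rewrite ?leey.
have irf : rintegrable (fine \o s).
  apply: le_integrable is_ => //; first exact/measurable_EFinP.
  move=> t _ /=; rewrite ger0_norm ?fine_ge0// gee0_abs//.
exists (fine \o s) => //; split.
  rewrite -lee_fin -rintegral_finE//; apply: le_trans isK.
  apply: ge0_le_integral => //; last by move=> t _; exact: fs.
    by move=> t _; rewrite lee_fin /= fine_ge0.
  exact/measurable_EFinP.
apply: (ae_imply (integrable_ae measurableT is_)) => t /(_ I) ft n.
by rewrite -lee_fin /= fineK//; exact: le_s.
Qed.

Lemma cintegrable_dom_ae f r : cmeas f -> rintegrable r -> (forall t, 0 <= r t) ->
  {ae mu, forall t, cabs (f t) <= r t} ->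
  cintegrable f /\ L1norm f <= Rintegral mu setT r.
Proof.
move=> mf hr r0 fr; have mc := measurable_cabs mf.
have le : (\int[mu]_t (cabs (f t))%:E <= \int[mu]_t (r t)%:E)%E.
  apply: ae_ge0_le_integral => //.
  - by move=> t _; rewrite lee_fin cabs_ge0.
  - exact/measurable_EFinP.
  - by move=> t _; rewrite lee_fin.
  - by apply/measurable_EFinP; exact: rintegrable_meas.
  - by apply: ae_imply fr _ => t h _; rewrite lee_fin.
have ia : rintegrable (@cabs R \o f).
  apply/integrableP; split; first exact/measurable_EFinP.
  under eq_integral do rewrite /= ger0_norm ?cabs_ge0//.
  by apply: le_lt_trans le _; rewrite rintegral_finE// ltry.
split; first by apply: (cintegrable_dom mf ia).
by rewrite -lee_fin -!rintegral_finE.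
Qed.

(** The modulus |F n - f|, viewed as a complex function and dominated by r + r, is fed to
    [cint_dominated]. *)
Lemma L1norm_dominated (F : nat -> R -> C) f r : (forall n, cmeas (F n)) -> cmeas f ->
  rintegrable r -> (forall n t, cabs (F n t) <= r t) ->
  (forall t, ccvg (fun n => F n t) (f t)) ->
  (fun n => L1norm (fun t => F n t - f t)) @ \oo --> (0 : R).
Proof.
move=> mF mf hr Fr Ff.
have fr t : cabs (f t) <= r t by apply: ccvg_abs_le (Ff t) _.
have mB n : cmeas (fun t => cmk (cabs (F n t - f t)) 0).
  split; last exact: measurable_cst.
  exact: (measurable_cabs (cmeasB (mF n) mf)).
have [] := @cint_dominated _ (fun n t => cmk (cabs (F n t - f t)) 0) (fun=> 0)
  (fun t => r t + r t) mB (cmeas_cst 0) (rintegrableD hr hr).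
- move=> n t; rewrite cabs_real ger0_norm ?cabs_ge0//.
  by apply: le_trans (cabsB _ _) _; rewrite lerD.
- move=> t; apply/ccvgP => e e0; have /ccvgP/(_ e e0)[N hN] := Ff t.
  exists N => n Nn; rewrite subr0 cabs_real ger0_norm ?cabs_ge0//.
  exact: hN.
- by move=> h _; move: h; rewrite cint0.
Qed.

(** Riesz-Fischer for summable increments: the moduli of the increments have an integrable majorant
    of their sums, so the telescoping series converges almost everywhere and dominatedly. *)
Lemma L1_complete (F : nat -> R -> C) (b : nat -> R) (B : R) : (forall n, cintegrable (F n)) ->
  (forall n, L1norm (fun t => F n.+1 t - F n t) <= b n) ->
  (forall n, \sum_(k < n) b k <= B) ->
  exists2 G : R -> C, cintegrable G & (fun n => L1norm (fun t => F n t - G t)) @ \oo --> (0 : R).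
Proof.
move=> iF Fb bB.
pose D n t := F n.+1 t - F n t.
have iD n : cintegrable (D n) by exact: cintegrableB.
have isum n : rintegrable (fun t => \sum_(k < n) cabs (D k t)) /\
    Rintegral mu setT (fun t => \sum_(k < n) cabs (D k t)) <= \sum_(k < n) b k.
  elim: n => [|n [IH1 IH2]].
    under eq_fun do rewrite big_ord0; rewrite big_ord0; split; first exact: integrable0.
    by rewrite /Rintegral integral0.
  under eq_fun do rewrite big_ord_recr /=; split.
    by apply: rintegrableD => //; exact: cintegrable_abs (iD n).
  rewrite RintegralD//; last exact: cintegrable_abs (iD n).
  by rewrite big_ord_recr lerD//; exact: Fb.
have [||n|s is_ [_ [N [mN N0 hN]]]] := @monotone_dominated (fun n t => \sum_(k < n) cabs (D k t)) B
    (fun n => (isum n).1).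
- by move=> n t; apply: sumr_ge0 => k _; exact: cabs_ge0.
- by move=> t; apply/nondecreasing_seqP => n; rewrite big_ord_recr lerDl cabs_ge0.
- exact: le_trans (isum n).2 (bB n).
(* Multiplying by the indicator of the complement of the null set [N] makes convergence and
   domination hold at every point, as [L1norm_dominated] requires. *)
pose j (t : R) : C := cmk (\1_(~` N) t) 0.
have jN t : N t -> j t = 0 by move=> Nt; rewrite /j indicE memNset.
have jNN t : ~ N t -> j t = 1 by move=> Nt; rewrite /j indicE mem_set.
have mj : cmeas j.
  split; last exact: measurable_cst.
  by apply: measurable_indic; exact: measurableC.
pose G t := j t * F 0%N t + csum (fun k => j t * D k t).
have sum0 t n : ~ N t -> \sum_(k < n) cabs (D k t) <= s t.
  by move=> Nt; apply: contrapT => hn; apply: Nt; apply: hN => /= ht; exact: hn (ht n).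
have cG t : csum_to (fun k => j t * D k t) (csum (fun k => j t * D k t)).
  have [Nt|Nt] := pselect (N t).
    apply: (@csum_to_abs _ _ (fun=> 0) 0); first by move=> k; rewrite jN// mul0r cabs0.
    by move=> n; rewrite big1.
  apply: (@csum_to_abs _ _ (fun k => cabs (D k t)) (s t)) => [k|n]; last exact: sum0.
  by rewrite jNN// mul1r.
have tele t n : j t * F n t = j t * F 0%N t + \sum_(k < n) j t * D k t.
  elim: n => [|n IH]; first by rewrite big_ord0 addr0.
  by rewrite big_ord_recr /= addrA -IH -mulrDr /D addrC subrK.
have jFG t : ccvg (fun n => j t * F n t) (G t).
  apply: (ccvg_ext (fun n => esym (tele t n))); apply: ccvgD; first exact: ccvg_cst.
  exact: (@csum_toE _ _ _).1 (cG t).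
have mjF n : cmeas (fun t => j t * F n t).
  by apply: cmeasM => //; exact: cintegrable_meas.
have mG : cmeas G.
  split.
    apply: (@measurable_fun_cvg _ (measurableTypeR R) _ _
      (fun n => @cRe R \o (fun t => j t * F n t))).
      by move=> n; case: (mjF n).
    by move=> t _; case: (jFG t).
  apply: (@measurable_fun_cvg _ (measurableTypeR R) _ _
      (fun n => @cIm R \o (fun t => j t * F n t))).
    by move=> n; case: (mjF n).
  by move=> t _; case: (jFG t).
pose r t := cabs (F 0%N t) + `|s t|.
have ir : rintegrable r.
  by apply: rintegrableD; [exact: cintegrable_abs (iF 0%N)|exact: rintegrable_abs].
have jFr n t : cabs (j t * F n t) <= r t.
  have [Nt|Nt] := pselect (N t).
    by rewrite jN// mul0r cabs0 addr_ge0 ?cabs_ge0.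
  rewrite tele jNN// mul1r (le_trans (cabsD _ _))// lerD2l.
  under eq_bigr do rewrite mul1r.
  apply: le_trans (cabs_sum _ _ _) _; apply: le_trans (ler_norm _).
  exact: sum0.
have iG : cintegrable G.
  by apply: (cintegrable_dom mG ir) => t; apply: ccvg_abs_le (jFG t) _ => n.
exists G => //.
rewrite (_ : (fun n => _) = fun n => L1norm (fun t => j t * F n t - G t)).
  exact: L1norm_dominated mjF mG ir jFr jFG.
apply/funext => n; apply: aeeq_L1norm.
- by apply: cmeasB => //; exact: cintegrable_meas.
- exact: cmeasB.
- exists N; split => // t /= ht; apply: contrapT => Nt; apply: ht.
  by rewrite jNN// mul1r.
Qed.
End L1Space.

(** * Density, continuity of translation and duality in L^1 *)

Section Density.
Context {R : realType}.
Local Notation C := (R[i]).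
Local Notation mu := (@lebesgue_measure R).
Implicit Types (f g h : R -> C) (r : R -> R).

Definition ind (A t : R) : R := \1_(`[- A, A]%classic) t.

Lemma ind_in A t : `|t| <= A -> ind A t = 1.
Proof. by move=> tA; rewrite /ind indicE mem_set//= in_itv /= -ler_norml. Qed.
Lemma ind_out A t : A < `|t| -> ind A t = 0.
Proof. by move=> tA; rewrite /ind indicE memNset//= in_itv /= -ler_norml leNgt tA. Qed.
Lemma ind_rintegrable A : rintegrable (ind A).
Proof. exact: integrable_indic_itv. Qed.
Lemma ind_Rintegral A : 0 <= A -> Rintegral mu setT (ind A) = 2 * A.
Proof.
move=> A0; rewrite /Rintegral /ind integral_indic//= setIT lebesgue_measure_itv /= lte_fin.
have [->|An0] := eqVneq A 0; first by rewrite oppr0 ltxx /= mulr0.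
by rewrite gtrN// ?lt0r ?An0// -EFinB /= opprK mulr2n mulrDl mul1r.
Qed.

Lemma cintegrable_compact f A M : cmeas f -> 0 <= A -> (forall t, cabs (f t) <= M) ->
  (forall t, A < `|t| -> f t = 0) -> cintegrable f /\ L1norm f <= M * (2 * A).
Proof.
move=> mf A0 fM fA.
have h t : cabs (f t) <= M * ind A t.
  have [tA|tA] := leP `|t| A; first by rewrite ind_in// mulr1.
  by rewrite fA// cabs0 ind_out// mulr0.
have hi : rintegrable (fun t => M * ind A t) by apply: rintegrableZ; exact: ind_rintegrable.
split; first exact: cintegrable_dom hi h.
apply: le_trans (le_L1norm mf hi h) _.
by rewrite RintegralZl ?ind_Rintegral//; exact: ind_rintegrable.
Qed.

(** A trapezoid, equal to 1 up to |t| = N and to 0 from N + 1 on; being continuous, it truncates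
    without leaving C_0. *)
Definition cutoff (N t : R) : R := Num.max 0 (Num.min 1 (N + 1 - `|t|)).

Lemma continuous_cutoff N : continuous (cutoff N).
Proof.
move=> t; apply: (@continuous_max R R (fun=> 0) (fun t => Num.min 1 (N + 1 - `|t|))).
  exact: cst_continuous.
apply: (@continuous_min R R (fun=> 1) (fun t => N + 1 - `|t|)).
  exact: cst_continuous.
by apply: cvgB; [exact: cvg_cst|exact: norm_continuous].
Qed.
Lemma cutoff_ge0 N t : 0 <= cutoff N t. Proof. by rewrite le_max lexx. Qed.
Lemma cutoff_le1 N t : cutoff N t <= 1.
Proof. by rewrite ge_max ler01 ge_min lexx. Qed.
Lemma cutoff_in N t : `|t| <= N -> cutoff N t = 1.
Proof. by move=> tN; rewrite /cutoff min_l ?max_r//; lra. Qed.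
Lemma cutoff_out N t : N + 1 <= `|t| -> cutoff N t = 0.
Proof. by move=> tN; rewrite /cutoff max_l// ge_min; apply/orP; right; lra. Qed.
Lemma cutoff_nd N M t : N <= M -> cutoff N t <= cutoff M t.
Proof.
by move=> NM; rewrite /cutoff le_max2// le_min2//; lra.
Qed.

Definition ccut (N t : R) : C := cmk (cutoff N t) 0.
Lemma cabs_ccut N t : cabs (ccut N t) = cutoff N t.
Proof. by rewrite cabs_real ger0_norm ?cutoff_ge0. Qed.
Lemma cmeas_ccut N : cmeas (ccut N).
Proof. by apply: cmeas_cont; [exact: continuous_cutoff|exact: cst_continuous]. Qed.

Definition ccontinuous f := continuous (@cRe R \o f) /\ continuous (@cIm R \o f).

Lemma C0_compact f A : ccontinuous f -> (forall t, A < `|t| -> f t = 0) -> C0 f.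
Proof.
move=> [h1 h2] hA; split=> //; split=> // e e0; exists A => t /hA ->.
by rewrite cabs0.
Qed.

Lemma ccontinuousM f g : ccontinuous f -> ccontinuous g -> ccontinuous (fun t => f t * g t).
Proof.
move=> [f1 f2] [g1 g2]; split => t.
  rewrite (_ : _ \o _ = fun t => cRe (f t) * cRe (g t) - cIm (f t) * cIm (g t)).
    by apply: cvgB; apply: cvgM; solve [exact: f1|exact: f2|exact: g1|exact: g2].
  by apply/funext => x /=; rewrite cReImE.
rewrite (_ : _ \o _ = fun t => cRe (f t) * cIm (g t) + cIm (f t) * cRe (g t)).
  by apply: cvgD; apply: cvgM; solve [exact: f1|exact: f2|exact: g1|exact: g2].
by apply/funext => x /=; rewrite cReImE.
Qed.

Lemma ccontinuous_ccut N : ccontinuous (ccut N).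
Proof. by split; [exact: continuous_cutoff|exact: cst_continuous]. Qed.

Lemma ccut_out N f t : N + 1 < `|t| -> ccut N t * f t = 0.
Proof. by move=> tN; rewrite /ccut cutoff_out ?ltW// mul0r. Qed.

Lemma C0_ccut N f : ccontinuous f -> C0 (fun t => ccut N t * f t).
Proof.
move=> cf; apply: (@C0_compact _ (N + 1)); last by move=> t; exact: ccut_out.
exact: ccontinuousM (ccontinuous_ccut N) cf.
Qed.

Lemma ccut_integrable N f : 0 <= N -> ccontinuous f -> cintegrable (fun t => ccut N t * f t).
Proof.
move=> N0 cf; have hC := C0_ccut N cf.
apply: (@cintegrable_compact _ (N + 1) _ (C0_meas hC) _ (fun t => le_supnorm t hC) _).1.
  by rewrite addr_ge0.
by move=> t; exact: ccut_out.
Qed.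

(** Density of continuous functions is used on an interval of finite measure; the factor [ind A]
    ignores what [k] does outside it. *)
Lemma approx_real r A e : rintegrable r -> 0 < e -> exists2 k : R -> R, continuous k &
  rintegrable (fun t => ind A t * `|r t - k t|) /\
  Rintegral mu setT (fun t => ind A t * `|r t - k t|) < e.
Proof.
move=> ir e0; set E : set (measurableTypeR R) := `[- A, A]%classic.
have mE : measurable E by exact: measurable_itv.
have Efin : (mu E < +oo)%E.
  by rewrite lebesgue_measure_itv /=; case: ifP => // _; rewrite -EFinB ltry.
have irE : mu.-integrable E (EFin \o r) by exact: integrableS ir.
have [g_ [cg ig /fine_cvgP[]]] := approximation_continuous_integrable mE Efin irE.
move=> [N1 _ h1] /cvgrPdist_lt/(_ e e0)[N2 _ h2].
pose n := maxn N1 N2; exists (g_ n); first exact: cg.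
have ii : mu.-integrable E (EFin \o (fun t => `|r t - g_ n t|)).
  by apply: integrable_norm; exact: (integrableB mE irE (ig n)).
have eqf : (fun t => ind A t * `|r t - g_ n t|) = (fun t => `|r t - g_ n t|) \_ E.
  apply/funext => t; rewrite /ind patchE indicE -/E; case: (_ \in _) => /=.
    by rewrite mul1r.
  by rewrite mul0r.
rewrite eqf; split.
  move/(integrable_mkcond _ mE) : ii.
  by rewrite /rintegrable -restrict_EFin.
rewrite -Rintegral_mkcond.
have /= := h2 n (leq_maxr _ _); rewrite sub0r normrN; apply: le_lt_trans.
exact: ler_norm.
Qed.

Lemma density f e : cintegrable f -> 0 < e -> exists (k : R -> C) (N : R),
  [/\ 0 <= N, ccontinuous k & L1norm (fun t => f t - ccut N t * k t) < e].
Proof.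
move=> hf e0; have e3 : 0 < e / 3 by rewrite divr_gt0.
have mf := cintegrable_meas hf.
have : (fun n : nat => L1norm (fun t => ccut n%:R t * f t - f t)) @ \oo --> (0 : R).
  apply: (@L1norm_dominated R _ _ (@cabs R \o f)) => //.
  - by move=> n; apply: cmeasM => //; exact: cmeas_ccut.
  - exact: cintegrable_abs.
  - move=> n t; rewrite cabsM cabs_ccut -[leRHS]mul1r ler_wpM2r ?cabs_ge0//.
    exact: cutoff_le1.
  - move=> t; apply/ccvgP => d d0; exists (Num.bound t) => n tn.
    rewrite /ccut cutoff_in.
      by rewrite -[cmk 1 0]/(1 : C) mul1r subrr cabs0.
    have := archi_boundP (normr_ge0 t); rewrite /Num.bound normr_id => h.
    by apply: ltW; apply: lt_le_trans h _; rewrite ler_nat.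
move/cvgrPdist_lt => /(_ _ e3)[n _ /(_ n (leqnn n))] /=.
rewrite sub0r normrN ger0_norm ?L1norm_ge0// => hn.
have [i1 i2] := hf.
(* The window reaches n + 1 because [ccut n%:R] vanishes only beyond that point. *)
have [k1 ck1 [ik1 hk1]] := approx_real (n%:R + 1) i1 e3.
have [k2 ck2 [ik2 hk2]] := approx_real (n%:R + 1) i2 e3.
pose k t := cmk (k1 t) (k2 t).
have ck : ccontinuous k by [].
have ick := ccut_integrable (ler0n R n) ck.
have icf : cintegrable (fun t => ccut n%:R t * f t).
  apply: (@cintegrableM _ _ _ 1) => //; first exact: cmeas_ccut.
  by move=> t; rewrite cabs_ccut cutoff_le1.
exists k, n%:R; split => //.
(* One third pays for the truncation, the other two for the real and the imaginary part. *)
have -> : e = e / 3 + (e / 3 + e / 3) by lra.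
apply: (@le_lt_trans _ _ (L1norm (fun t => ccut n%:R t * f t - f t) +
   L1norm (fun t => ccut n%:R t * f t - ccut n%:R t * k t))).
  rewrite -(L1normN (fun t => ccut n%:R t * f t - f t)).
  rewrite -[leLHS](@eq_L1norm _ (fun t => - (ccut n%:R t * f t - f t) +
     (ccut n%:R t * f t - ccut n%:R t * k t))); last by move=> t; ring.
  apply: L1normD; last exact: cintegrableB.
  by under eq_fun do rewrite opprB; exact: cintegrableB.
rewrite ltrD//.
apply: (@le_lt_trans _ _ (Rintegral mu setT (fun t => ind (n%:R + 1) t * `|cRe (f t) - k1 t| +
     ind (n%:R + 1) t * `|cIm (f t) - k2 t|))).
  apply: le_L1norm; first exact: cintegrable_meas (cintegrableB icf ick).
    exact: rintegrableD.
  move=> t; rewrite -mulrBr -mulrDr; have [tn|tn] := leP `|t| (n%:R + 1).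
    rewrite ind_in// mul1r cabsM cabs_ccut; apply: (@le_trans _ _ (cabs (f t - k t))).
      by rewrite -[leRHS]mul1r ler_wpM2r ?cabs_ge0// cutoff_le1.
    by apply: le_trans (cabs_le _) _; rewrite !cReImE.
  by rewrite (ccut_out (fun t => f t - k t))// cabs0 ind_out// mul0r.
by rewrite RintegralD//; rewrite ltrD.
Qed.

(** For a continuous function of compact support, uniform continuity times the length of the support
    suffices; the general case follows by density, since translation preserves the L^1 norm. *)
Lemma L1_translation f e : cintegrable f -> 0 < e ->
  exists2 d, 0 < d & forall s, `|s| < d -> L1norm (fun t => tau s f t - f t) <= e.
Proof.
move=> hf e0; have e3 : 0 < e / 3 by rewrite divr_gt0.
have [k0 [N [N0 ck hk]]] := density hf e3.
pose k t := ccut N t * k0 t; have Ck : C0 k by exact: C0_ccut.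
have ik : cintegrable k by exact: ccut_integrable.
(* For |s| < 1 both [k] and its translate vanish beyond N + 2, so the uniform bound is integrated
   over length 2 (N + 2). *)
have A0 : 0 < 2 * (N + 2) by lra.
have [d d0 hd] := C0_unif_cont Ck (divr_gt0 e3 A0).
exists (Num.min d 1); first by rewrite lt_min d0 ltr01.
move=> s; rewrite lt_min => /andP[sd s1].
have ikd := cintegrableB (cintegrable_tau s ik) ik.
have hfk := cintegrableB hf ik.
have h1 : L1norm (fun t => tau s k t - k t) <= e / 3.
  have := @cintegrable_compact (fun t => tau s k t - k t) (N + 2) (e / 3 / (2 * (N + 2)))
    (cintegrable_meas ikd).
  case.
  - by rewrite addr_ge0.
  - by move=> t; apply: ltW; exact: hd.
  - move=> t tN; rewrite /tau /k !ccut_out ?subrr//; first lra.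
    by have := lerB_dist t s; lra.
  - by move=> _; rewrite divfK// gt_eqF.
apply: (@le_trans _ _ (L1norm (tau s (fun t => f t - k t)) + (L1norm (fun t => tau s k t - k t) +
   L1norm (fun t => f t - k t)))).
  rewrite -(L1normN (fun t => f t - k t)).
  rewrite -[leLHS](@eq_L1norm _ (fun t => tau s (fun t => f t - k t) t + ((tau s k t - k t) +
     - (f t - k t)))); last by move=> t; rewrite /tau; ring.
  have iN : cintegrable (fun t => - (f t - k t)).
    by under eq_fun do rewrite opprB; exact: cintegrableB.
  apply: le_trans (L1normD _ _) _; [exact: cintegrable_tau|exact: cintegrableD|].
  by rewrite lerD2l; exact: L1normD.
rewrite L1norm_tau//.
have -> : e = e / 3 + (e / 3 + e / 3) by lra.
by rewrite lerD// ?lerD//; exact: ltW.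
Qed.

Lemma conv0_le g f : cintegrable g -> C0 f -> (forall t, cabs (f t) <= 1) ->
  cabs (conv f g 0) <= L1norm g.
Proof.
move=> ig hf f1; apply: le_trans (conv_le 0 hf ig) _.
by rewrite -[leRHS]mul1r ler_wpM2r ?L1norm_ge0// supnorm_le.
Qed.

(* Test against [conj k / (|k| + d)], for a continuous compactly supported [k] close to [g]. *)
Lemma L1_duality g M : cintegrable g ->
  (forall f A, C0 f -> (forall t, A < `|t| -> f t = 0) -> (forall t, cabs (f t) <= 1) ->
    cabs (conv f g 0) <= M) -> L1norm g <= M.
Proof.
move=> ig hM; apply/ler_addgt0Pr => e e0; have e3 : 0 < e / 3 by rewrite divr_gt0.
have [k0 [N [N0 ck hk]]] := density ig e3.
pose k t := ccut N t * k0 t; have Ck : C0 k by exact: C0_ccut.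
have ik : cintegrable k by exact: ccut_integrable.
have A0 : 0 < 2 * (N + 1) by lra.
(* The regularised test function gives |k|^2 / (|k| + d) >= |k| - d, a loss of [d] over a support of
   length at most 2 (N + 1), hence e / 3 in all. *)
pose d := e / 3 / (2 * (N + 1)); have d0 : 0 < d by exact: divr_gt0.
have kd t : 0 < cabs (k t) + d by rewrite ltr_wpDl ?cabs_ge0.
pose w t := cmk ((cabs (k t) + d)^-1) 0 * conjc (k t).
have cw : ccontinuous w.
  have [ck1 [ck2 _]] := Ck.
  apply: ccontinuousM; split.
  - move=> t; apply: cvgV; first by rewrite gt_eqF.
    by apply: cvgD; [exact: continuous_cabs|exact: cvg_cst].
  - exact: cst_continuous.
  - by move=> t; rewrite (_ : _ \o _ = @cRe R \o k); [exact: ck1|apply/funext => x /=; case: (k x)].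
  - move=> t; rewrite (_ : _ \o _ = fun t => - cIm (k t)).
      by apply: cvgN; exact: ck2.
    by apply/funext => x /=; case: (k x).
have cabsw t : cabs (w t) = cabs (k t) / (cabs (k t) + d).
  by rewrite cabsM cabs_real cabs_conj ger0_norm ?invr_ge0 1?mulrC// ltW.
have w1 t : cabs (w t) <= 1 by rewrite cabsw ler_pdivrMr// mul1r lerDl ltW.
(* The reflection undoes the one in [conv f g 0], which integrates f (- t) g t. *)
pose f t := w (- t).
have w0 t : N + 1 < `|t| -> w t = 0.
  by move=> tN; rewrite /w /k ccut_out// conjc0 mulr0.
have f0 t : N + 1 < `|t| -> f t = 0 by rewrite /f -normrN => /w0.
have Cf : C0 f.
  apply: (@C0_compact _ (N + 1)) => //.
  split=> t.
    exact: (@continuous_comp _ _ _ (fun t : R => - t) (@cRe R \o w) t (preserves_opp.1 t) (cw.1 _)).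
  exact: (@continuous_comp _ _ _ (fun t : R => - t) (@cIm R \o w) t (preserves_opp.1 t) (cw.2 _)).
have f1 t : cabs (f t) <= 1 by exact: w1.
have ind1 := ind_rintegrable (N + 1).
have hkk : L1norm k - e / 3 <= cabs (conv f k 0).
  have -> : e / 3 = Rintegral mu setT (fun t => d * ind (N + 1) t).
    by rewrite RintegralZl// ind_Rintegral ?addr_ge0// divfK// gt_eqF.
  rewrite /L1norm -RintegralB//; last exact: rintegrableZ; last exact: cintegrable_abs.
  apply: le_trans (cRe_le _); apply: le_trans (ler_norm _); rewrite /conv /cint cReE.
  apply: le_Rintegral => //.
  - by apply: rintegrableB; [exact: cintegrable_abs|exact: rintegrableZ].
  - by case: (conv_cintegrable 0 Cf ik).
  move=> t _ /=; rewrite /f sub0r opprK /w.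
  have -> : cmk (cabs (k t) + d)^-1 0 * conjc (k t) * k t =
      cmk (cabs (k t) ^+ 2 / (cabs (k t) + d)) 0.
    rewrite -mulrA [conjc _ * _]mulrC mulc_conj.
    by apply: cext; rewrite !cReImE ?mulr0 ?mul0r ?subr0 ?addr0// mulrC.
  rewrite cReE; have [tN|tN] := leP `|t| (N + 1).
    (* Cross-multiplied, the difference |k|^2 - (|k| - d)(|k| + d) is d^2. *)
    rewrite ind_in// mulr1 ler_pdivlMr// -subr_ge0.
    by rewrite [leRHS](_ : _ = d ^+ 2) ?sqr_ge0//; ring.
  by rewrite /k ccut_out// cabs0 expr0n mul0r ind_out// mulr0 subr0.
have h1 : cabs (conv f k 0) <= M + e / 3.
  have -> : conv f k 0 = conv f g 0 - conv f (fun t => g t - k t) 0.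
    by rewrite convBr//; ring.
  apply: le_trans (cabsB _ _) _; apply: lerD; first exact: (hM f (N + 1)).
  apply: le_trans (ltW hk); apply: conv0_le => //; exact: cintegrableB.
have := L1norm_le_add ig ik; move: hk hkk h1; rewrite -/(k _).
by rewrite (_ : (fun t => g t - ccut N t * k0 t) = fun t => g t - k t)//; lra.
Qed.

(** [L1_duality] with bound 0 applied to g - h: C_0 separates the points of L^1. All
    almost-everywhere identities between operators come from here. *)
Lemma conv_determines g h : cintegrable g -> cintegrable h ->
  (forall f, C0 f -> conv f g 0 = conv f h 0) -> aeeq g h.
Proof.
move=> ig ih gh; apply: L1norm_eq0 => //; apply/eqP; rewrite eq_le L1norm_ge0 andbT.
apply: L1_duality; first exact: cintegrableB.
by move=> f A hf _ _; rewrite convBr// gh// subrr cabs0.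
Qed.
End Density.

(** * Functionals on C_0 and mollification *)

Section ConvolutionC0.
Context {R : realType}.
Local Notation C := (R[i]).
Local Notation mu := (@lebesgue_measure R).
Implicit Types (f g h k F : R -> C).

Lemma ccontinuousP f : (forall x e, 0 < e -> exists2 d, 0 < d &
    forall s, `|s| < d -> cabs (f (x - s) - f x) < e) -> ccontinuous f.
Proof.
move=> hf; split=> x; apply/cvgrPdist_lt => e /(hf x)[d d0 hd]; exists d => //= y /= xy.
  rewrite distrC -cReN -cReD; apply: le_lt_trans (cRe_le _) _.
  by have := hd (x - y) xy; rewrite subKr.
rewrite distrC -cImN -cImD; apply: le_lt_trans (cIm_le _) _.
by have := hd (x - y) xy; rewrite subKr.
Qed.

Lemma cint_prod_le f k e : cmeas f -> cintegrable k ->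
  (forall t, cabs (f t * k t) <= e * cabs (k t)) ->
  cabs (cint (fun t => f t * k t)) <= e * L1norm k.
Proof.
move=> mf ik h; have ia := cintegrable_abs ik.
have iz : rintegrable (fun t => e * cabs (k t)) by exact: rintegrableZ.
have mfk : cmeas (fun t => f t * k t) by apply: cmeasM => //; exact: cintegrable_meas.
apply: le_trans (cabs_cint_le _) _; first exact: cintegrable_dom iz h.
by rewrite {2}/L1norm -RintegralZl//; exact: le_L1norm.
Qed.

Lemma C0_conv F k A : C0 F -> cintegrable k -> (forall t, A < `|t| -> k t = 0) -> C0 (conv F k).
Proof.
move=> hF ik kA.
(* The added 1 keeps the divisor positive when [k] is null. *)
have L0 : 0 < L1norm k + 1 by rewrite ltr_wpDl ?L1norm_ge0.
have Le e : 0 < e -> e / (L1norm k + 1) * L1norm k < e.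
  by move=> e0; rewrite mulrAC ltr_pdivrMr// ltr_pM2l// ltrDl.
have [] : ccontinuous (conv F k).
  apply: ccontinuousP => x e e0.
  have [d d0 hd] := C0_unif_cont hF (divr_gt0 e0 L0); exists d => // s sd.
  rewrite -conv_shift -convBl//; last exact: C0_shift.
  apply: le_lt_trans (Le _ e0); apply: cint_prod_le => //.
    apply: (@cmeas_reflect _ (fun t => F (t - s) - F t) x).
    apply: C0_meas; apply: C0B => //; exact: C0_shift.
  by move=> t; rewrite cabsM ler_wpM2r ?cabs_ge0// ltW// hd.
move=> h1 h2; split=> //; split=> // e e0.
have [_ [_ h3]] := hF; have [M hM] := h3 _ (divr_gt0 e0 L0).
(* If |x| > M + A and [t] is in the support of [k], then |x - t| > M, where [F] is small. *)
exists (M + A) => x hx; apply: le_lt_trans (Le _ e0); apply: cint_prod_le => //.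
  exact: cmeas_reflect (C0_meas hF).
move=> t; rewrite cabsM; have [tA|tA] := leP `|t| A; last by rewrite kA// cabs0 !mulr0.
rewrite ler_wpM2r ?cabs_ge0// ltW// hM//.
by have := lerB_dist x t; lra.
Qed.

Lemma conv_comm f g x : cmeas f -> cintegrable (fun t => f (x - t) * g t) ->
  conv f g x = conv g f x.
Proof.
move=> mf ifg; rewrite /conv -[LHS](cint_preserves (preserves_reflect x))//.
by apply: eq_cint => t /=; rewrite opprB addrC subrK mulrC.
Qed.

Definition bump (d t : R) : C := cmk (Num.max 0 (d - `|t|)) 0.

Lemma bump_out d t : d < `|t| -> bump d t = 0.
Proof. by move=> dt; rewrite /bump max_l//; lra. Qed.

Lemma cabs_bump d t : cabs (bump d t) = cRe (bump d t).
Proof. by rewrite cabs_real ger0_norm// le_max lexx. Qed.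

Lemma C0_bump d : C0 (bump d).
Proof.
apply: (@C0_compact _ _ d); last exact: bump_out.
split; last exact: cst_continuous.
move=> t; apply: (@continuous_max R R (fun=> 0) (fun t => d - `|t|)).
  exact: cst_continuous.
by apply: cvgB; [exact: cvg_cst|exact: norm_continuous].
Qed.

Lemma cintegrable_bump d : 0 <= d -> cintegrable (bump d).
Proof.
move=> d0; have hC := C0_bump d.
exact: (@cintegrable_compact _ _ d _ (C0_meas hC) d0 (fun t => le_supnorm t hC) (@bump_out d)).1.
Qed.

(** The tent has height at least d / 2 on |t| <= d / 2. *)
Lemma L1norm_bump_gt0 d : 0 < d -> 0 < L1norm (bump d).
Proof.
move=> d0; have i2 := ind_rintegrable (d / 2).
apply: (@lt_le_trans _ _ (Rintegral mu setT (fun t => d / 2 * ind (d / 2) t))).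
  by rewrite RintegralZl// ind_Rintegral; [rewrite !mulr_gt0//; lra|lra].
apply: le_Rintegral => //; first exact: rintegrableZ.
  by apply: cintegrable_abs; apply: cintegrable_bump; exact: ltW.
move=> t _ /=; rewrite cabs_bump /bump cReE.
have [td|td] := leP `|t| (d / 2).
  by rewrite ind_in// mulr1 le_max; apply/orP; right; lra.
by rewrite ind_out// mulr0 le_max lexx.
Qed.

Lemma cint_bump d : cint (bump d) = cmk (L1norm (bump d)) 0.
Proof.
apply: cext; rewrite /cint !cReImE.
  by apply: eq_Rintegral => t _ /=; rewrite cabs_bump.
by rewrite /Rintegral integral0.
Qed.

Definition mollifier (d : R) (t : R) : C := cmk (L1norm (bump d))^-1 0 * bump d t.

Lemma mollifierP d : 0 < d -> [/\ C0 (mollifier d), cintegrable (mollifier d),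
  (forall t, d < `|t| -> mollifier d t = 0), L1norm (mollifier d) = 1 & cint (mollifier d) = 1].
Proof.
move=> d0; have ib := cintegrable_bump (ltW d0); have L0 := L1norm_bump_gt0 d0.
split.
- by apply: C0Z; exact: C0_bump.
- exact: cintegrableZ.
- by move=> t td; rewrite /mollifier bump_out// mulr0.
- rewrite L1normZ// cabs_real ger0_norm ?invr_ge0 ?ltW// mulVf// gt_eqF//.
- rewrite cintZ// cint_bump; apply: cext; rewrite !cReImE ?mulr0 ?mul0r ?subr0 ?addr0//.
  by rewrite mulVf// gt_eqF.
Qed.
End ConvolutionC0.

(** * Moving a bounded functional on C_0 under a convolution integral *)

Section Averaging.
Context {R : realType}.
Local Notation C := (R[i]).
Local Notation mu := (@lebesgue_measure R).
Implicit Types (f g h k F : R -> C).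
Variables (Lam : (R -> C) -> C) (K : R).
Hypothesis Lam_lin : forall a f g, C0 f -> C0 g ->
  Lam (fun t => a * f t + g t) = a * Lam f + Lam g.
Hypothesis K0 : 0 <= K.
Hypothesis Lam_le : forall f, C0 f -> cabs (Lam f) <= K * supnorm f.

Lemma Lam_bound f M : C0 f -> (forall t, cabs (f t) <= M) -> cabs (Lam f) <= K * M.
Proof. by move=> hf fM; apply: le_trans (Lam_le hf) _; rewrite ler_wpM2l// supnorm_le. Qed.

Lemma LamB f g : C0 f -> C0 g -> Lam (fun t => f t - g t) = Lam f - Lam g.
Proof.
move=> hf hg; rewrite addrC -mulN1r -Lam_lin//.
by congr Lam; apply/funext => t; rewrite mulN1r addrC.
Qed.

Lemma LamD f g : C0 f -> C0 g -> Lam (fun t => f t + g t) = Lam f + Lam g.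
Proof.
move=> hf hg; rewrite -(mul1r (Lam f)) -Lam_lin//.
by congr Lam; apply/funext => t; rewrite mul1r.
Qed.

Lemma LamZ a f : C0 f -> Lam (fun t => a * f t) = a * Lam f.
Proof.
move=> hf; have h0 : Lam (fun=> 0) = 0.
  transitivity (Lam (fun t => f t - f t)); last by rewrite LamB// subrr.
  by congr Lam; apply/funext => t; rewrite subrr.
rewrite -[RHS]addr0 -h0 -Lam_lin//; last exact: C0_0.
by congr Lam; apply/funext => t; rewrite addr0.
Qed.

(** The translates of [F] seen through [Lam]: a bounded function of [s], continuous because [F] is
    uniformly continuous. It is the scalar integrand in [Lam_conv]. *)
Definition orbit_fun F (s : R) : C := Lam (fun t => F (t - s)).

Lemma orbit_fun_dist F e d : C0 F -> 0 < e ->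
  (forall s t, `|s| < d -> cabs (F (t - s) - F t) < e) ->
  forall s y, `|s - y| < d -> cabs (orbit_fun F s - orbit_fun F y) <= K * e.
Proof.
move=> hF e0 hd s y sy; rewrite /orbit_fun -LamB; [|exact: C0_shift..].
apply: Lam_bound; first by apply: C0B; exact: C0_shift.
move=> t; have := hd (s - y) (t - y) sy.
rewrite (_ : t - y - (s - y) = t - s); last by ring.
exact: ltW.
Qed.

Lemma orbit_fun_cont F : C0 F -> ccontinuous (orbit_fun F).
Proof.
move=> hF; apply: ccontinuousP => x e e0.
have K1 : 0 < K + 1 by rewrite ltr_wpDl.
have e1 : 0 < e / (K + 1) by exact: divr_gt0.
have [d d0 hd] := C0_unif_cont hF e1; exists d => // s sd.
have h : `|x - s - x| < d by rewrite addrAC subrr sub0r normrN.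
apply: le_lt_trans (orbit_fun_dist hF e1 hd h) _.
by rewrite mulrCA gtr_pMr// ltr_pdivrMr// mul1r ltrDl.
Qed.

Lemma orbit_fun_le F s : C0 F -> cabs (orbit_fun F s) <= K * supnorm F.
Proof.
by move=> hF; apply: Lam_bound; [exact: C0_shift|move=> t; exact: le_supnorm].
Qed.

Lemma orbit_fun_meas F : C0 F -> cmeas (orbit_fun F).
Proof. by move=> /orbit_fun_cont[h1 h2]; exact: cmeas_cont. Qed.

Lemma orbit_fun_integrable F k : C0 F -> cintegrable k ->
  cintegrable (fun s => orbit_fun F s * k s).
Proof.
move=> hF; apply: cintegrableM (fun s => orbit_fun_le s hF).
exact: orbit_fun_meas.
Qed.

Definition defect F k : C := Lam (conv F k) - cint (fun s => orbit_fun F s * k s).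

(** If [k] lives within [d] of [y], then [conv F k] is uniformly close to (cint k) F(. - y), and
    [orbit_fun F] is nearly constant on the support. Both terms of the defect are thus within K e
    |k|_1 of [cint k * orbit_fun F y], whence the factor 2. *)
Lemma defect_local F e d k y : C0 F -> 0 < e ->
  (forall s t, `|s| < d -> cabs (F (t - s) - F t) < e) ->
  cintegrable k -> (forall t, d <= `|t - y| -> k t = 0) ->
  cabs (defect F k) <= 2 * K * e * L1norm k.
Proof.
move=> hF e0 hd ik ky.
have hFy := C0_shift y hF.
have hA t : `|y| + d < `|t| -> k t = 0.
  by move=> ht; apply: ky; have := lerB_dist t y; lra.
have hC := C0_conv hF ik hA.
have -> : defect F k = (Lam (conv F k) - cint k * orbit_fun F y) -
    (cint (fun s => orbit_fun F s * k s) - cint k * orbit_fun F y) by rewrite /defect; ring.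
apply: le_trans (cabsB _ _) _.
have -> : 2 * K * e * L1norm k = K * (e * L1norm k) + K * e * L1norm k by ring.
apply: lerD.
  rewrite /orbit_fun -LamZ// -LamB//; last exact: C0Z.
  apply: Lam_bound; first by apply: C0B => //; exact: C0Z.
  move=> x; have := conv_cintegrable x hF ik => iF.
  have -> : conv F k x - cint k * F (x - y) = cint (fun t => (F (x - t) - F (x - y)) * k t).
    rewrite mulrC -cintZ// -cintB//; last exact: cintegrableZ.
    by apply: eq_cint => t; rewrite mulrBl.
  apply: cint_prod_le => //.
    by apply: cmeasB; [exact: cmeas_reflect (C0_meas hF)|exact: cmeas_cst].
  move=> t; rewrite cabsM; have [ty|ty] := ltP `|t - y| d; last by rewrite ky// cabs0 !mulr0.
  rewrite ler_wpM2r ?cabs_ge0//.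
  have := hd (t - y) (x - y) ty.
  by rewrite (_ : x - y - (t - y) = x - t); [move/ltW|ring].
have iO := orbit_fun_integrable hF ik.
rewrite mulrC -cintZ// -cintB//; last exact: cintegrableZ.
rewrite (@eq_cint _ _ (fun t => (orbit_fun F t - orbit_fun F y) * k t)); last first.
  by move=> t; rewrite mulrBl.
apply: cint_prod_le => //.
  by apply: cmeasB; [exact: orbit_fun_meas|exact: cmeas_cst].
move=> t; rewrite cabsM; have [ty|ty] := ltP `|t - y| d; last by rewrite ky// cabs0 !mulr0.
by rewrite ler_wpM2r ?cabs_ge0//; exact: orbit_fun_dist hF e0 hd _ _ ty.
Qed.

Lemma defectD F k k' A : C0 F -> cintegrable k -> cintegrable k' ->
  (forall t, A < `|t| -> k t = 0) -> (forall t, A < `|t| -> k' t = 0) ->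
  defect F (fun t => k t + k' t) = defect F k + defect F k'.
Proof.
move=> hF ik ik' kA kA'; rewrite /defect.
have -> : conv F (fun t => k t + k' t) = fun x => conv F k x + conv F k' x.
  by apply/funext => x; rewrite convDr.
rewrite LamD; [|exact: C0_conv hF ik kA|exact: C0_conv hF ik' kA'].
rewrite (@eq_cint _ _ (fun s => orbit_fun F s * k s + orbit_fun F s * k' s)); last first.
  by move=> t; rewrite mulrDr.
by rewrite cintD; [ring|exact: orbit_fun_integrable..].
Qed.

(** Induction on the number [n] of slices of length [d] covering the support. L^1 norms add over
    disjoint slices, so the local errors sum to a bound that does not depend on [n]. *)
Lemma defect_le F e d n a k : C0 F -> 0 < e -> 0 < d ->
  (forall s t, `|s| < d -> cabs (F (t - s) - F t) < e) ->
  cintegrable k -> (forall t, k t != 0 -> a <= t < a + n%:R * d) ->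
  cabs (defect F k) <= 2 * K * e * L1norm k.
Proof.
move=> hF e0 d0 hd; elim: n k => [|n IH] k ik ka.
  apply: (@defect_local _ _ d _ a) => // t _; apply/eqP; apply: contraT => /ka.
  by rewrite mul0r addr0 => /andP[/le_lt_trans h /h]; rewrite ltxx.
pose b := a + n%:R * d.
(* The indicator splits off the last slice [b, b + d); the half-open form gives |t - b| < d there,
   as [defect_local] asks. *)
pose j t : C := cmk (\1_(`]-oo, b[%classic) t) 0.
have j1 t : t < b -> j t = 1 by move=> tb; rewrite /j indicE mem_set//= in_itv.
have j0 t : b <= t -> j t = 0.
  by move=> tb; rewrite /j indicE memNset//= in_itv /= ltNge tb.
have mj : cmeas j.
  split; last exact: measurable_cst.
  by apply: measurable_indic; exact: measurable_itv.
pose k1 t := j t * k t; pose k2 t := (1 - j t) * k t.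
have ik1 : cintegrable k1.
  apply: (@cintegrableM _ _ _ 1) => // t.
  by have [tb|tb] := ltP t b; [rewrite j1// cabs1|rewrite j0// cabs0].
have ik2 : cintegrable k2.
  apply: (@cintegrableM _ (fun t => 1 - j t) _ 1) => //.
    by apply: cmeasB => //; exact: cmeas_cst.
  by move=> t; have [tb|tb] := ltP t b; [rewrite j1// subrr cabs0|rewrite j0// subr0 cabs1].
have kE : k = fun t => k1 t + k2 t by apply/funext => t; rewrite /k1 /k2; ring.
have kout t : `|a| + n.+1%:R * d < `|t| -> k t = 0.
  move=> ht; apply/eqP; apply: contraT => /ka /andP[h1 h2]; exfalso.
  have nd : 0 <= n.+1%:R * d by rewrite mulr_ge0// ltW.
  by move: ht; rewrite ltNge ler_norml; have := ler_norm a; have := ler_norm (- a);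
    rewrite normrN => ha1 ha2; move/negP; apply; apply/andP; split; lra.
have L12 : L1norm k = L1norm k1 + L1norm k2.
  rewrite /L1norm -RintegralD//; [|exact: cintegrable_abs..].
  apply: eq_Rintegral => t _ /=; rewrite /k1 /k2 !cabsM -mulrDl.
  by have [tb|tb] := ltP t b; [rewrite j1//|rewrite j0//];
    rewrite ?subrr ?subr0 cabs0 cabs1 ?addr0 ?add0r mul1r.
rewrite {1}kE (@defectD _ _ _ (`|a| + n.+1%:R * d))//; last 2 first.
- by move=> t ht; rewrite /k1 kout// mulr0.
- by move=> t ht; rewrite /k2 kout// mulr0.
apply: le_trans (cabsD _ _) _; rewrite L12 mulrDr; apply: lerD.
  apply: IH => // t; rewrite /k1; have [tb|tb] := ltP t b; last by rewrite j0// mul0r eqxx.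
  by rewrite j1// mul1r => /ka /andP[-> _].
apply: (@defect_local _ _ d _ b) => // t tbd; rewrite /k2.
have [tb|tb] := ltP t b; first by rewrite j1// subrr mul0r.
rewrite j0// subr0 mul1r; apply/eqP; apply: contraT => /ka /andP[_].
rewrite ger0_norm ?subr_ge0// in tbd.
by rewrite -natr1 mulrDl mul1r addrA -/b ltNge; move/negP; case; lra.
Qed.

(* The functional commutes with the vector-valued integral
   [conv F k = \int k(s) F(. - s) ds]. *)
Lemma Lam_conv F k A : C0 F -> cintegrable k -> (forall t, A < `|t| -> k t = 0) ->
  Lam (conv F k) = cint (fun s => orbit_fun F s * k s).
Proof.
move=> hF ik kA; apply/eqP; rewrite -subr_eq0; apply/eqP/cabs0_eq0/eqP.
rewrite eq_le cabs_ge0 andbT -/(defect F k); apply/ler_addgt0Pr => e e0; rewrite add0r.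
(* Uniform continuity is taken at e / c so that the bound of [defect_le] ends below [e]; the 1 keeps
   [c] positive. *)
pose c := 2 * K * L1norm k + 1.
have c0 : 0 < c by rewrite ltr_wpDl// !mulr_ge0// L1norm_ge0.
have ec : 0 < e / c by exact: divr_gt0.
have [d d0 hd] := C0_unif_cont hF ec.
have A10 : 0 <= `|A| + 1 by rewrite addr_ge0.
(* Enough slices of length [d], starting at - (|A| + 1), to cover the support of [k]. *)
pose n := Num.bound ((2 * (`|A| + 1)) / d).
have hn : 2 * (`|A| + 1) < n%:R * d.
  rewrite -ltr_pdivrMr//; apply: archi_boundP.
  by rewrite divr_ge0// ?mulr_ge0// ltW.
have := @defect_le F (e / c) d n (- (`|A| + 1)) k hF ec d0 hd ik; move/(_ _)/le_trans; apply.
  move=> t kt; have : `|t| <= A by rewrite leNgt; apply: contra kt => /kA ->.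
  by rewrite ler_norml => /andP[h1 h2]; have := ler_norm A => h3; apply/andP; split; lra.
rewrite (_ : 2 * K * (e / c) * L1norm k = e * ((2 * K * L1norm k) / c)); last by ring.
rewrite -[leRHS]mulr1 ler_wpM2l//; first exact: ltW.
by rewrite ler_pdivrMr// mul1r /c lerDl.
Qed.

(** [Lam_conv] is used twice, with the roles of [f] and the mollifier exchanged. By commutativity of
    convolution the integral of [orbit_fun (mollifier d)] against [f] is also the average of
    [orbit_fun f] against the mollifier, that is, of values [Lam] takes on translates of [f] by at
    most [d]. *)
Lemma mollified_close d e f A : 0 < d -> 0 <= e ->
  (forall s, `|s| <= d -> cabs (Lam (fun t => f (t - s)) - Lam f) <= e) ->
  C0 f -> 0 <= A -> (forall t, A < `|t| -> f t = 0) ->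
  cabs (cint (fun s => orbit_fun (mollifier d) s * f s) - Lam f) <= e.
Proof.
move=> d0 e0 hd hf A0 fA; have [Cg ig g0 g1 gi] := mollifierP d0.
have if_ : cintegrable f.
  exact: (@cintegrable_compact _ _ A _ (C0_meas hf) A0 (fun t => le_supnorm t hf) fA).1.
rewrite -(Lam_conv Cg if_ fA).
have -> : conv (mollifier d) f = conv f (mollifier d).
  apply/funext => x; apply: conv_comm; first exact: C0_meas.
  exact: conv_cintegrable.
rewrite (Lam_conv hf ig g0) -[Lam f]mulr1 -gi -cintZ// -cintB//; last exact: cintegrableZ.
  rewrite (@eq_cint _ _ (fun s => (orbit_fun f s - Lam f) * mollifier d s)); last first.
    by move=> t; rewrite mulrBl.
  rewrite -[leRHS]mulr1 -g1; apply: cint_prod_le => //.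
    by apply: cmeasB; [exact: orbit_fun_meas|exact: cmeas_cst].
  move=> t; rewrite cabsM; have [td|td] := leP `|t| d; last by rewrite g0// cabs0 !mulr0.
  by rewrite ler_wpM2r ?cabs_ge0//; exact: hd.
exact: orbit_fun_integrable.
Qed.
End Averaging.

(** * Functionals with an L^1 density *)

Section Representation.
Context {R : realType}.
Local Notation C := (R[i]).
Local Notation mu := (@lebesgue_measure R).
Implicit Types (f g h F : R -> C).

Lemma sum_half_le n : \sum_(k < n) 2 * (2^-1 : R) ^+ k <= 4.
Proof.
have -> : \sum_(k < n) 2 * (2^-1 : R) ^+ k = 4 - 4 * 2^-1 ^+ n.
  elim: n => [|n IH]; first by rewrite big_ord0 expr0 mulr1 subrr.
  by rewrite big_ord_recr /= IH exprS; lra.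
by rewrite lerBlDr lerDl mulr_ge0// exprn_ge0// invr_ge0.
Qed.

Lemma cvg_half : (fun n => (2^-1 : R) ^+ n) @ \oo --> (0 : R).
Proof. by apply: cvg_expr; rewrite ger0_norm ?invr_ge0// invf_lt1// ltr1n. Qed.

(** The truncated moduli increase with [n], so monotone convergence provides an integrable majorant;
    at each [t] the truncation is inactive once n >= |t|. *)
Lemma cintegrable_of_ccut g M : ccontinuous g ->
  (forall n : nat, L1norm (fun t => ccut n%:R t * g t) <= M) -> cintegrable g.
Proof.
move=> cg gM; have mg : cmeas g by case: cg => h1 h2; exact: cmeas_cont.
have [||n|s is_ [_ sg]] := @monotone_dominated R
  (fun n t => cabs (ccut n%:R t * g t)) M
  (fun n => cintegrable_abs (ccut_integrable (ler0n R n) cg)).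
- by move=> n t; exact: cabs_ge0.
- move=> t; apply/nondecreasing_seqP => n; rewrite !cabsM !cabs_ccut ler_wpM2r ?cabs_ge0//.
  by apply: cutoff_nd; rewrite ler_nat.
- exact: gM.
apply: (@cintegrable_dom_ae _ _ (fun t => `|s t|) mg (rintegrable_abs is_) _ _).1 => //.
apply: ae_imply sg _ => t /(_ (Num.bound t)); rewrite /ccut cutoff_in.
  by rewrite -[cmk 1 0]/(1 : C) mul1r => /le_trans; apply; exact: ler_norm.
by have := archi_boundP (normr_ge0 t); rewrite /Num.bound normr_id => /ltW.
Qed.

(* A bounded functional on C_0 is given by a measure; the hypothesis [Lam_trans] forces the
   measure to be the L^1-limit of its mollifications, hence to have a density. *)
Lemma representation (Lam : (R -> C) -> C) (K : R) :
  (forall a f g, C0 f -> C0 g -> Lam (fun t => a * f t + g t) = a * Lam f + Lam g) ->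
  0 <= K -> (forall f, C0 f -> cabs (Lam f) <= K * supnorm f) ->
  (forall e, 0 < e -> exists2 d, 0 < d & forall s f, `|s| <= d -> C0 f ->
     cabs (Lam (fun t => f (t - s)) - Lam f) <= e * supnorm f) ->
  exists2 G : R -> C, cintegrable G & forall f, C0 f -> Lam f = conv f G 0.
Proof.
move=> Lam_lin K0 Lam_le Lam_trans.
have h0 n : 0 < (2^-1 : R) ^+ n by rewrite exprn_gt0// invr_gt0.
(* The radii are chosen to make the n-th mollification accurate to 2^-n, so that consecutive
   differences are summable. *)
have hd n : {d : R | 0 < d /\ forall s f, `|s| <= d -> C0 f ->
     cabs (Lam (fun t => f (t - s)) - Lam f) <= 2^-1 ^+ n * supnorm f}.
  by apply: cid; have [d d0 h] := Lam_trans _ (h0 n); exists d.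
pose d n := projT1 (hd n).
have d0 n : 0 < d n by exact: (projT2 (hd n)).1.
have dP n := (projT2 (hd n)).2.
pose ph n t := orbit_fun Lam (mollifier (d n)) t.
(* Reflected because the density is to be paired through [conv f G 0], the integral of f (- t) G
   t. *)
pose phi n t := ph n (- t).
have Cg n : C0 (mollifier (d n)) by have [] := mollifierP (d0 n).
have cph n : ccontinuous (ph n) by exact: (orbit_fun_cont Lam_lin K0 Lam_le).
have cphi n : ccontinuous (phi n).
  split=> t.
    exact: (@continuous_comp _ _ _ (fun t : R => - t) (@cRe R \o ph n) t (preserves_opp.1 t)
      ((cph n).1 _)).
  exact: (@continuous_comp _ _ _ (fun t : R => - t) (@cIm R \o ph n) t (preserves_opp.1 t)
      ((cph n).2 _)).
have close n f A : C0 f -> (forall t, A < `|t| -> f t = 0) ->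
    cabs (conv f (phi n) 0 - Lam f) <= 2^-1 ^+ n * supnorm f.
  move=> hf fA.
  have fA' t : `|A| < `|t| -> f t = 0 by move=> tA; apply: fA; exact: le_lt_trans (ler_norm _) tA.
  have if_ : cintegrable f.
    exact: (@cintegrable_compact _ _ `|A| _ (C0_meas hf) (normr_ge0 _)
      (fun t => le_supnorm t hf) fA').1.
  have -> : conv f (phi n) 0 = cint (fun s => ph n s * f s).
    rewrite -[RHS](cint_preserves preserves_opp).
      by apply: eq_cint => t /=; rewrite sub0r mulrC.
    exact: (orbit_fun_integrable Lam_lin K0 Lam_le (Cg n) if_).
  apply: (mollified_close Lam_lin K0 Lam_le (d0 n) _ _ hf (normr_ge0 A) fA').
    by rewrite mulr_ge0 ?supnorm_ge0// ltW.
  by move=> s sd; exact: dP.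
have close1 n f A : C0 f -> (forall t, A < `|t| -> f t = 0) -> (forall t, cabs (f t) <= 1) ->
    cabs (conv f (phi n) 0 - Lam f) <= 2^-1 ^+ n.
  move=> hf fA f1; apply: le_trans (close n f A hf fA) _.
  by rewrite -[leRHS]mulr1 ler_wpM2l ?supnorm_le// ltW.
(* The cutoff is even, so it moves from [phi n] to the test function. [K] then bounds [Lam] on that
   function, and 1 bounds the error 2^-n. *)
have iphi n : cintegrable (phi n).
  apply: (@cintegrable_of_ccut _ (K + 1)) => // m; apply: L1_duality.
    exact: ccut_integrable.
  move=> f A hf fA f1; pose f' t := ccut m%:R t * f t.
  have hf' : C0 f' by apply: C0_ccut; case: hf => ? [? _].
  have f'1 t : cabs (f' t) <= 1.
    rewrite cabsM cabs_ccut -[leRHS]mulr1.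
    by rewrite ler_pM ?cutoff_ge0 ?cabs_ge0 ?cutoff_le1.
  have -> : conv f (fun t => ccut m%:R t * phi n t) 0 = conv f' (phi n) 0.
    apply: eq_cint => t; rewrite mulrA sub0r /f' [f _ * _]mulrC; congr (_ * _ * _).
    by rewrite /ccut /cutoff normrN.
  rewrite -[X in cabs X](subrK (Lam f')) addrC.
  apply: le_trans (cabsD _ _) _; apply: lerD.
    by apply: le_trans (Lam_le _ hf') _; rewrite -[leRHS]mulr1 ler_wpM2l// supnorm_le.
  apply: (@le_trans _ _ (2^-1 ^+ n)).
    by apply: (@close1 n f' A) => // t tA; rewrite /f' fA// mulr0.
  by rewrite exprn_ile1// ?invr_ge0// invf_le1// ler1n.
(* Two successive errors 2^-(n+1) + 2^-n are at most 2 * 2^-n, and these bounds sum to at most 4. *)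
have [||G iG cvG] := @L1_complete R phi (fun n => 2 * 2^-1 ^+ n) 4 iphi.
- move=> n; apply: L1_duality; first exact: cintegrableB.
  move=> f A hf fA f1; rewrite convBr//.
  have -> : conv f (phi n.+1) 0 - conv f (phi n) 0 =
    (conv f (phi n.+1) 0 - Lam f) - (conv f (phi n) 0 - Lam f) by ring.
  apply: le_trans (cabsB _ _) _.
  have := close1 n f A hf fA f1; have := close1 n.+1 f A hf fA f1.
  by have := h0 n; rewrite exprS; lra.
- exact: sum_half_le.
exists G => //.
have Gc f A : C0 f -> (forall t, A < `|t| -> f t = 0) -> Lam f = conv f G 0.
  move=> hf fA; apply: (@ccvg_unique _ (fun n => conv f (phi n) 0)).
    apply: (@ccvg_squeeze _ _ _ (fun n => 2^-1 ^+ n * supnorm f)).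
      by move=> n; exact: close hf fA.
    by rewrite -(mul0r (supnorm f)); apply: cvgMl; exact: cvg_half.
  apply: (@ccvg_squeeze _ _ _ (fun n => supnorm f * L1norm (fun t => phi n t - G t))).
    by move=> n; rewrite -convBr//; apply: conv_le => //; exact: cintegrableB.
  by rewrite -(mulr0 (supnorm f)); apply: cvgMr.
move=> f hf; apply/eqP; rewrite -subr_eq0; apply/eqP/cabs0_eq0/eqP.
rewrite eq_le cabs_ge0 andbT; apply/ler_addgt0Pr => e e0; rewrite add0r.
(* The identity passes from compact support to C_0 by truncation: a uniform error e / c costs [K]
   times that in [Lam] and [L1norm G] times that in the integral. *)
pose c := K + L1norm G + 1.
have c0 : 0 < c by rewrite ltr_wpDl// addr_ge0// L1norm_ge0.
have [hf1 [hf2 hf3]] := hf; have [M hM] := hf3 _ (divr_gt0 e0 c0).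
pose f' t := ccut M t * f t.
have hf' : C0 f' by exact: C0_ccut.
have dif t : cabs (f t - f' t) <= e / c.
  have [tM|tM] := leP `|t| M.
    rewrite /f' /ccut cutoff_in// -[cmk 1 0]/(1 : C) mul1r subrr cabs0.
    by rewrite divr_ge0// ltW.
  apply: (@le_trans _ _ (cabs (f t))); last exact: ltW (hM _ tM).
  have -> : f t - f' t = cmk (1 - cutoff M t) 0 * f t.
    by apply: cext; rewrite /f' /ccut !cReImE; ring.
  rewrite cabsM cabs_real -[leRHS]mul1r ler_wpM2r ?cabs_ge0//.
  by rewrite ger0_norm ?subr_ge0 ?cutoff_le1// lerBlDr lerDl cutoff_ge0.
have hB : C0 (fun t => f t - f' t) by exact: C0B.
have -> : Lam f - conv f G 0 = Lam (fun t => f t - f' t) - conv (fun t => f t - f' t) G 0.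
  rewrite (LamB Lam_lin)// convBl// (Gc f' (M + 1) hf'); first by ring.
  by move=> t; exact: ccut_out.
apply: le_trans (cabsB _ _) _.
apply: (@le_trans _ _ (K * (e / c) + (e / c) * L1norm G)).
  apply: lerD.
    by apply: le_trans (Lam_le _ hB) _; rewrite ler_wpM2l// supnorm_le.
  apply: le_trans (conv_le 0 hB iG) _.
  by rewrite ler_wpM2r ?L1norm_ge0// supnorm_le.
rewrite [K * _]mulrC -mulrDr -[leRHS]mulr1 mulrAC -mulrA ler_wpM2l//; first exact: ltW.
by rewrite ler_pdivrMr// mul1r /c lerDl.
Qed.
End Representation.

(** * Positive spectrum *)

Section Spectrum.
Context {R : realType}.
Local Notation C := (R[i]).
Local Notation mu := (@lebesgue_measure R).
Implicit Types (f g h F : R -> C).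

Lemma cabsV (z : C) : cabs z^-1 = (cabs z)^-1.
Proof. by apply: (@complexI R); rewrite fmorphV /= -!cabsE normfV. Qed.

Lemma ccvg_inv (u : nat -> C) l : (forall n, 1 <= cabs (u n)) -> 1 <= cabs l ->
  ccvg u l -> ccvg (fun n => (u n)^-1) l^-1.
Proof.
have nz (z : C) : 1 <= cabs z -> z != 0.
  by move=> z1; apply/eqP => z0; move: z1; rewrite z0 cabs0 ler10.
move=> u1 l1 /ccvgP h; apply/ccvgP => e /h[N hN]; exists N => n /hN; apply: le_lt_trans.
have -> : (u n)^-1 - l^-1 = (l - u n) * ((u n)^-1 * l^-1).
  by field; rewrite !nz.
rewrite !cabsM !cabsV cabsBC -[leRHS]mulr1 ler_wpM2l ?cabs_ge0//.
by rewrite mulr_ile1 ?invr_ge0 ?cabs_ge0// invf_le1// (lt_le_trans ltr01).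
Qed.

Lemma ccontinuous_inv f : (forall t, f t != 0) -> ccontinuous f -> ccontinuous (fun t => (f t)^-1).
Proof.
move=> f0 [h1 h2].
have n0 t : cRe (f t) ^+ 2 + cIm (f t) ^+ 2 != 0.
  by rewrite -cabs_sqr expf_eq0 /=; apply: contra (f0 t) => /eqP/cabs0_eq0 ->.
have cn : continuous (fun t => cRe (f t) ^+ 2 + cIm (f t) ^+ 2).
  by move=> t; apply: cvgD; rewrite expr2; under eq_fun do rewrite expr2;
    apply: cvgM; solve [exact: h1|exact: h2].
split=> t.
  rewrite (_ : _ \o _ = fun t => cRe (f t) / (cRe (f t) ^+ 2 + cIm (f t) ^+ 2)).
    by apply: cvgM; [exact: h1|apply: cvgV => //; exact: cn].
  by apply/funext => x /=; case: (f x).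
rewrite (_ : _ \o _ = fun t => - (cIm (f t) / (cRe (f t) ^+ 2 + cIm (f t) ^+ 2))).
  by apply: cvgN; apply: cvgM; [exact: h2|apply: cvgV => //; exact: cn].
by apply/funext => x /=; case: (f x).
Qed.

Lemma ccontinuous_expi (c : R) : ccontinuous (fun t => cexpi (c * t)).
Proof.
have ct : continuous (fun t : R => c * t) by move=> t; apply: cvgMr; exact: cvg_id.
split=> t.
  exact: (@continuous_comp _ _ _ (fun t : R => c * t) (@cos R) t (ct t) (@continuous_cos R _)).
exact: (@continuous_comp _ _ _ (fun t : R => c * t) (@sin R) t (ct t) (@continuous_sin R _)).
Qed.

(** Bernoulli's inequality makes the left side grow at least linearly if [x] is positive. *)
Lemma geometric_bound (x M r : R) : 0 <= x -> 0 < r -> (forall n, (1 + r) ^+ n * x <= M) -> x = 0.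
Proof.
move=> x0 r0 h; apply/eqP; rewrite eq_le x0 andbT leNgt; apply/negP => xp.
have B n : 1 + n%:R * r <= (1 + r) ^+ n.
  elim: n => [|n IH]; first by rewrite mul0r addr0 expr0.
  rewrite exprS; apply: (@le_trans _ _ ((1 + r) * (1 + n%:R * r))).
    have : 0 <= n%:R * r * r by rewrite !mulr_ge0// ltW.
    by rewrite -natr1; nra.
  by rewrite ler_wpM2l// addr_ge0// ltW.
have xr : 0 < x * r by exact: mulr_gt0.
have M0 : 0 <= M by have := h 0%N; rewrite expr0 mul1r; exact: le_trans.
have := archi_boundP (divr_ge0 M0 (ltW xr)); set n := Num.bound _.
rewrite ltr_pdivrMr// => hn.
have := h n; have := B n; rewrite -(ler_pM2r xp) => h1 h2.
have := le_trans h1 h2; rewrite mulrDl mul1r; nra.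
Qed.

Lemma derive_seq (g : R -> R) (l : R) : is_derive (0 : R) (1 : R) g l ->
  (fun n => n.+1%:R * (g (n.+1%:R^-1) - g 0)) @ \oo --> l.
Proof.
move=> hg; have dg : derivable g 0 1 by exact: ex_derive.
have := dg; rewrite /derivable => /cvg_ex[l' hl'].
have ll' : l' = l.
  rewrite -(@derive_val _ _ _ _ _ _ _ hg); apply/esym; exact: (cvg_lim (@Rhausdorff R) hl').
rewrite ll' in hl'.
have h0 : (fun n : nat => (n.+1%:R^-1 : R)) @ \oo --> (0 : R)^'.
  move=> A [d /= d0 hA].
  have [N _ hN] : \forall n \near \oo, `|0 - (n.+1%:R^-1 : R)| < d.
    by have /cvgrPdist_lt := @cvg_harmonic R; apply.
  exists N => // n /= Nn; apply: hA; first exact: hN.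
  by rewrite invr_eq0 pnatr_eq0.
rewrite (_ : (fun n => _) = (fun h : R => h^-1 *: ((g \o shift 0) (h *: (1 : R)) - g 0)) \o
    (fun n : nat => n.+1%:R^-1)); first exact: (cvg_comp _ _ h0 hl').
by apply/funext => n /=; rewrite invrK /GRing.scale /= addr0 mulr1.
Qed.

(** A discretisation of 1 + i x. With c = n + 1, its inverse is the geometric average sum_k c^k / (1
    + c)^(k+1) e^{-ikx/c}, so it has the same one-sided spectrum as 1/(1 + i x), and it satisfies a
    first-order recursion in the frequency. *)
Definition qden (n : nat) (x : R) : C :=
  1 + cmk n.+1%:R 0 * (1 - cexpi (- (x / n.+1%:R))).

Lemma qden_ge1 n x : 1 <= cabs (qden n x).
Proof.
apply: le_trans (cRe_le _); apply: le_trans (ler_norm _).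
rewrite /qden /cexpi !cReImE mul0r subr0 lerDl mulr_ge0// subr_ge0 cos_le1.
Qed.

(** Up to the constant 1, both components are difference quotients at 0 with step 1/(n + 1), of y
    |-> - cos (- (x y)) and y |-> - sin (- (x y)). *)
Lemma qden_cvg x : ccvg (fun n => qden n x) (cmk 1 x).
Proof.
split; rewrite ?(cReE 1 x) ?(cImE 1 x) /qden.
- have : is_derive (0 : R) (1 : R) (fun y => - cos (- (x * y))) 0.
    apply: is_derive_eq; rewrite !mulr0 oppr0 sin0.
    by rewrite /GRing.scale /= ?(mul0r, mulr0, oppr0, scale0r).
  move=> /derive_seq h.
  rewrite (_ : (fun n => _) =
      fun n => 1 + n.+1%:R * (- cos (- (x * n.+1%:R^-1)) - - cos (- (x * 0)))).
    by rewrite -[X in _ --> X]addr0; apply: cvgD => //; exact: cvg_cst.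
  apply/funext => n.
  by rewrite /cexpi !cReImE mul0r subr0 mulr0 oppr0 cos0 opprK [- cos _ + 1]addrC.
- have : is_derive (0 : R) (1 : R) (fun y => - sin (- (x * y))) x.
    apply: is_derive_eq; rewrite !mulr0 oppr0 cos0.
    by rewrite /GRing.scale /=; ring.
  move=> /derive_seq h.
  rewrite (_ : (fun n => _) =
      fun n => n.+1%:R * (- sin (- (x * n.+1%:R^-1)) - - sin (- (x * 0)))) //.
  by apply/funext => n; rewrite /cexpi !cReImE mulr0 oppr0 sin0; ring.
Qed.

Lemma ccontinuous_cst (a : C) : ccontinuous (fun=> a).
Proof. by split; exact: cst_continuous. Qed.

Lemma ccontinuousD f g : ccontinuous f -> ccontinuous g -> ccontinuous (fun t => f t + g t).
Proof.
move=> [f1 f2] [g1 g2]; split => t.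
  rewrite (_ : _ \o _ = fun t => cRe (f t) + cRe (g t)).
    by apply: cvgD; [exact: f1|exact: g1].
  by apply/funext => x /=; rewrite cReImE.
rewrite (_ : _ \o _ = fun t => cIm (f t) + cIm (g t)).
  by apply: cvgD; [exact: f2|exact: g2].
by apply/funext => x /=; rewrite cReImE.
Qed.

Lemma ccontinuous_qker n eps v :
  ccontinuous (fun t => cexpi (v * t) * (qden n (eps * t))^-1).
Proof.
apply: ccontinuousM; first exact: ccontinuous_expi.
apply: ccontinuous_inv.
  by move=> t; apply/eqP => h; have := qden_ge1 n (eps * t); rewrite h cabs0 ler10.
apply: ccontinuousD; first exact: ccontinuous_cst.
apply: ccontinuousM; first exact: ccontinuous_cst.
rewrite (_ : (fun t => _) = fun t => 1 + (-1) * cexpi (- (eps / n.+1%:R) * t)).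
  apply: ccontinuousD; first exact: ccontinuous_cst.
  by apply: ccontinuousM; [exact: ccontinuous_cst|exact: ccontinuous_expi].
by apply/funext => t; rewrite mulN1r; congr (1 - cexpi _); rewrite mulNr mulrAC.
Qed.

(* The bounded function [q v = \int e^{iv(x-t)} (qden n (eps (x-t)))^-1 h(t) dt] satisfies
   [q (v - eps/c) = (1 + 1/c) q v] for [v <= 0], with [c = n + 1], because the spectrum of [h]
   is positive; hence it vanishes there. *)
Lemma qker_annihilates h u eps n x : H1 h -> u <= 0 -> 0 < eps ->
  conv (fun t => cexpi (u * t) * (qden n (eps * t))^-1) h x = 0.
Proof.
move=> [ih hh] u0 e0; set c : R := n.+1%:R.
have c0 : 0 < c by rewrite ltr0Sn.
pose w v t := cexpi (v * t) * (qden n (eps * t))^-1.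
have qn t : qden n (eps * t) != 0.
  by apply/eqP => hq; have := qden_ge1 n (eps * t); rewrite hq cabs0 ler10.
have w1 v t : cabs (w v t) <= 1.
  by rewrite cabsM cabs_expi mul1r cabsV invf_le1 ?qden_ge1// (lt_le_trans ltr01 (qden_ge1 _ _)).
have mw v : cmeas (fun t => w v (x - t)).
  by apply: cmeas_reflect; have [h1 h2] := ccontinuous_qker n eps v; exact: cmeas_cont.
pose q v := conv (w v) h x.
have iq v : cintegrable (fun t => w v (x - t) * h t) by exact: (@cintegrableM _ _ _ 1).
have qle v : cabs (q v) <= L1norm h.
  rewrite -[leRHS]mul1r; apply: cint_prod_le => // t.
  by rewrite cabsM ler_wpM2r ?cabs_ge0.
have rec v : v <= 0 -> cabs (q (v - eps / c)) = (1 + c^-1) * cabs (q v).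
  move=> v0.
  (* In the difference of the two sides the numerators recombine into [qden], which cancels; what is
     left is e^{ivx} times the Fourier transform of [h] at [v], zero since v <= 0. *)
  have E : cmk (1 + c) 0 * q v = cmk c 0 * q (v - eps / c).
    apply/eqP; rewrite -subr_eq0; apply/eqP.
    have fz : cint (fun t => cexpi (v * x) * (h t * cexpi (- (t * v)))) = 0.
      by rewrite cintZ; [rewrite -/(fourier h v) hh// mulr0|exact: fourier_cintegrable].
    rewrite -[RHS]fz /q /conv -cintZ// -cintZ// -cintB; [|exact: cintegrableZ..].
    apply: eq_cint => t; rewrite /w; set y := x - t.
    have -> : cexpi ((v - eps / c) * y) = cexpi (v * y) * cexpi (- (eps * y / c)).
      by rewrite -cexpiD; congr cexpi; ring.
    have -> : cexpi (v * x) * (h t * cexpi (- (t * v))) = cexpi (v * y) * h t.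
      by rewrite mulrCA -cexpiD mulrC; congr (cexpi _ * _); rewrite /y; ring.
    have dE : qden n (eps * y) = cmk (1 + c) 0 - cmk c 0 * cexpi (- (eps * y / c)).
      by rewrite /qden; apply: cext; rewrite !cReImE -/c; ring.
    have := mulVf (qn y); rewrite {2}dE; set iv := (qden _ _)^-1 => key.
    by rewrite -[RHS]mulr1 -key; ring.
  have := congr1 (@cabs R) E; rewrite !cabsM !cabs_real !ger0_norm ?addr_ge0 ?ltW//.
  have cn0 : c != 0 by rewrite gt_eqF.
  by move=> EE; apply: (mulfI cn0); rewrite -EE; field.
have qn_ k : cabs (q (u - k%:R * (eps / c))) = (1 + c^-1) ^+ k * cabs (q u).
  elim: k => [|k IH]; first by rewrite mul0r subr0 expr0 mul1r.
  rewrite -natr1 mulrDl mul1r opprD addrA rec.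
    by rewrite IH exprS mulrA.
  by rewrite subr_le0 (le_trans u0)// mulr_ge0// ltW// divr_gt0.
apply: cabs0_eq0; apply: (@geometric_bound _ (L1norm h) c^-1).
- exact: cabs_ge0.
- by rewrite invr_gt0.
- by move=> k; rewrite -qn_.
Qed.

Definition pole (eps t : R) : C := (cmk 1 (eps * t))^-1.

Lemma pole_den_ge1 (y : R) : 1 <= cabs (cmk 1 y).
Proof. by apply: le_trans (cRe_le _); rewrite cReE normr1. Qed.

Lemma ccontinuous_pole eps : ccontinuous (pole eps).
Proof.
apply: ccontinuous_inv.
  by move=> t; apply/eqP => h; have := pole_den_ge1 (eps * t); rewrite h cabs0 ler10.
split; first exact: cst_continuous.
by move=> t; apply: cvgMr; exact: cvg_id.
Qed.

Lemma cabs_pole eps t : cabs (pole eps t) <= 1.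
Proof. by rewrite cabsV invf_le1 ?pole_den_ge1// (lt_le_trans ltr01 (pole_den_ge1 _)). Qed.

Lemma C0_expi_pole u eps : 0 < eps -> C0 (fun t => cexpi (u * t) * pole eps t).
Proof.
move=> e0; have [h1 h2] := ccontinuousM (ccontinuous_expi u) (ccontinuous_pole eps).
split=> //; split=> // e e1; exists (e^-1 / eps) => t.
rewrite ltr_pdivrMr// => ht; rewrite cabsM cabs_expi mul1r cabsV invf_plt ?posrE//; last first.
  exact: lt_le_trans ltr01 (pole_den_ge1 _).
apply: lt_le_trans ht _; apply: le_trans (cIm_le _).
by rewrite cImE normrM (gtr0_norm e0) mulrC.
Qed.

Lemma pole_annihilates h u eps x : H1 h -> u <= 0 -> 0 < eps ->
  conv (fun t => cexpi (u * t) * pole eps t) h x = 0.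
Proof.
move=> hh u0 e0; have ih := H1_cintegrable hh.
apply: (@ccvg_unique _ (fun n => conv (fun t => cexpi (u * t) * (qden n (eps * t))^-1) h x)).
  apply: (@cint_dominated _ _ _ (@cabs R \o h)).
  - move=> n; apply: cmeasM; last exact: cintegrable_meas.
    apply: (@cmeas_reflect _ (fun t => cexpi (u * t) * (qden n (eps * t))^-1)).
    by have [h1 h2] := ccontinuous_qker n eps u; exact: cmeas_cont.
  - apply: cmeasM; last exact: cintegrable_meas.
    by apply: (@cmeas_reflect _ (fun t => cexpi (u * t) * pole eps t)); apply: C0_meas;
      exact: C0_expi_pole.
  - exact: cintegrable_abs.
  - move=> n t; rewrite !cabsM cabs_expi mul1r cabsV -[leRHS]mul1r ler_wpM2r ?cabs_ge0//.
    by rewrite invf_le1 ?qden_ge1// (lt_le_trans ltr01 (qden_ge1 _ _)).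
  - move=> t; apply: (@ccvg_ext _
      (fun n => cexpi (u * (x - t)) * h t * (qden n (eps * (x - t)))^-1)).
      by move=> n; ring.
    rewrite (_ : cexpi _ * _ * h t = cexpi (u * (x - t)) * h t * pole eps (x - t)); last by ring.
    apply: ccvgZ; apply: ccvg_inv; [by move=> n; exact: qden_ge1|exact: pole_den_ge1|].
    exact: qden_cvg.
by apply: ccvg_ext (ccvg_cst 0) => n; rewrite qker_annihilates.
Qed.

(** The damped characters e^{iut} / (1 + i t/(n+1)) lie in C_0 and annihilate [h], hence pair to 0
    with [G]. They tend boundedly to e^{iut}, so dominated convergence identifies the limit with the
    Fourier transform of [G] at [u]. *)
Lemma H1_transfer h G : H1 h -> cintegrable G ->
  (forall f, C0 f -> (forall x, conv f h x = 0) -> conv f G 0 = 0) -> H1 G.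
Proof.
move=> hh iG hG; split=> // u u0.
pose w n t := cexpi (u * t) * pole n.+1%:R^-1 t.
have e0 n : 0 < (n.+1%:R^-1 : R) by rewrite invr_gt0 ltr0Sn.
have Cw n : C0 (w n) by exact: C0_expi_pole.
apply: (@ccvg_unique _ (fun n => conv (w n) G 0)); last first.
  apply: ccvg_ext (ccvg_cst 0) => n; apply/esym; apply: hG => // x.
  exact: pole_annihilates.
apply: (@cint_dominated _ _ _ (@cabs R \o G)).
- move=> n; apply: cmeasM; last exact: cintegrable_meas.
  by apply: (@cmeas_reflect _ (w n)); exact: C0_meas.
- exact: cintegrable_meas (fourier_cintegrable u iG).
- exact: cintegrable_abs.
- move=> n t; rewrite !cabsM cabs_expi mul1r -[leRHS]mul1r ler_wpM2r ?cabs_ge0//.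
  exact: cabs_pole.
move=> t; apply: (@ccvg_ext _ (fun n => G t * cexpi (- (t * u)) * pole n.+1%:R^-1 (- t))).
  by move=> n; rewrite /w sub0r mulrN [u * t]mulrC; ring.
rewrite -[X in ccvg _ X]mulr1; apply: ccvgZ; rewrite -[X in ccvg _ X]invr1; apply: ccvg_inv.
- by move=> n; exact: pole_den_ge1.
- by rewrite cabs1.
split; first exact: cvg_cst.
rewrite cIm1 /=; rewrite -[X in _ --> X](mul0r (- t)); apply: cvgMl.
exact: cvg_harmonic.
Qed.
End Spectrum.

(** * Surjectivity *)

Section PointEvaluations.
Variables (K : fieldType) (X : Type) (x0 : X) (m : nat) (Fs : nat -> X -> K).

Let evalmx n (x : nat -> X) : 'M[K]_(n, m) := \matrix_(j < n, i < m) Fs i (x j).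

Let maximal_evals : exists n x, forall k y, (\rank (evalmx k y) <= \rank (evalmx n x))%N.
Proof.
pose P r := `[< exists n x, \rank (evalmx n x) = r >].
have exP : exists r, P r.
  by exists (\rank (evalmx 0 (fun=> x0))); apply/asboolP; exists 0%N, (fun=> x0).
have leP r : P r -> (r <= m)%N by move=> /asboolP[n [x <-]]; exact: rank_leq_col.
case: (ex_maxnP exP leP) => r /asboolP[n [x <-]] hr.
by exists n, x => k y; apply: hr; apply/asboolP; exists k, y.
Qed.

(** Finite-dimensional biduality: a vector killed by every linear relation among the functions
    [Fs i] is a combination of vectors of their values at points. *)
Lemma point_evaluations_span (v : nat -> K) :
  (forall a : nat -> K, (forall x, \sum_(i < m) a i * Fs i x = 0) ->
     \sum_(i < m) a i * v i = 0) ->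
  exists (n : nat) (c : nat -> K) (x : nat -> X),
    forall i, (i < m)%N -> v i = \sum_(j < n) c j * Fs i (x j).
Proof.
move=> hv; have [n [x hmax]] := maximal_evals.
set A := evalmx n x in hmax.
(* [A] has maximal rank among evaluation matrices, so adding the point [y] cannot enlarge its row
   space. *)
have rowA (y : X) : (\row_(i < m) Fs i y <= A)%MS.
  pose x' j := if (j < n)%N then x j else y.
  pose A' := evalmx n.+1 x'.
  have AA' : (A <= A')%MS.
    apply/row_subP => j; rewrite (_ : row j A = row (widen_ord (leqnSn n) j) A').
      exact: row_sub.
    by apply/rowP => i; rewrite !mxE /= /x' ltn_ord.
  have yA' : (\row_(i < m) Fs i y <= A')%MS.
    rewrite (_ : \row_i _ = row ord_max A'); first exact: row_sub.
    by apply/rowP => i; rewrite !mxE /= /x' ltnn.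
  apply: submx_trans yA' _.
  have := mxrank_leqif_sup AA'; rewrite /leqif => -[h1 <-].
  by rewrite eqn_leq h1 hmax.
(* Each column of the cokernel of [A] is a linear relation among the functions at every point, by
   [rowA]; the hypothesis makes it a relation for [v]. The coefficients are extended by 0 past
   [m]. *)
have vA : (\row_(i < m) v i <= A)%MS.
  rewrite submxE; apply/eqP/rowP => k; rewrite !mxE.
  pose a (i : nat) : K := if insub i is Some o then cokermx A o k else 0.
  have ha : forall y, \sum_(i < m) a i * Fs i y = 0.
    move=> y; have := rowA y; rewrite submxE => /eqP/rowP/(_ k); rewrite !mxE => h.
    rewrite -[RHS]h; apply: eq_bigr => i _; rewrite [RHS]mulrC /a valK; congr (_ * _).
    by rewrite mxE.
  rewrite -[RHS](hv a ha); apply: eq_bigr => i _; rewrite [LHS]mulrC /a valK; congr (_ * _).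
  by rewrite mxE.
have [D hD] := submxP vA.
exists n, (fun j => if insub j is Some o then D 0 o else 0), x => i im.
have := congr1 (fun M : 'M[K]_(1, m) => M 0 (Ordinal im)) hD; rewrite !mxE /= => ->.
by apply: eq_bigr => j _; rewrite mxE /= valK.
Qed.
End PointEvaluations.

(** * From a functional on A_0 to an operator in PM *)

Section Surjectivity.
Context {R : realType}.
Local Notation C := (R[i]).
Variable eta : (R -> C) -> C.
Hypothesis heta : dualA0 eta.
Implicit Types (f g h F G : R -> C).

Lemma dual_conv_le M f h : (forall F, A0 F -> cabs (eta F) <= M * A0norm F) -> 0 <= M ->
  C0 f -> H1 h -> cabs (eta (conv f h)) <= M * (supnorm f * L1norm h).
Proof.
move=> hM M0 hf hh; apply: le_trans (hM _ (A0_conv hf hh)) _.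
by rewrite ler_wpM2l// A0norm_conv.
Qed.

Lemma dual_density h : H1 h ->
  exists2 G, H1 G & forall f, C0 f -> eta (conv f h) = conv f G 0.
Proof.
move=> hh; have ih := H1_cintegrable hh; have [M M0 hM] := dualA0_bound heta.
pose Lam f := eta (conv f h).
have [||||G iG hG] := @representation R Lam (M * L1norm h).
- move=> a f g hf hg; rewrite /Lam -heta.1; [|exact: A0_conv..].
  by congr eta; apply/funext => x; rewrite convDl ?convZl//; exact: C0Z.
- by rewrite mulr_ge0// L1norm_ge0.
- by move=> f hf; rewrite -mulrA [L1norm h * _]mulrC; exact: dual_conv_le.
- move=> e e0; have M1 : 0 < M + 1 by rewrite ltr_wpDl.
  have [d d0 hd] := L1_translation ih (divr_gt0 e0 M1).
  exists (d / 2); first by rewrite divr_gt0.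
  (* Halving [d] turns the strict bound of [L1_translation] into the closed one of
     [representation]. *)
  move=> s f sd hf; have {sd}sd : `|s| < d by lra.
  have hts := H1_tau s hh.
  have -> : Lam (fun t => f (t - s)) - Lam f = eta (conv f (fun t => tau s h t - h t)).
    rewrite /Lam -(dualA0B heta); [|exact: A0_conv (C0_shift s hf) hh|exact: A0_conv].
    congr eta; apply/funext => x; rewrite convBr//; last exact: cintegrable_tau.
    by rewrite conv_shift conv_tau.
  apply: le_trans (dual_conv_le hM M0 hf (H1B hts hh)) _.
  rewrite mulrCA mulrC ler_wpM2r ?supnorm_ge0//.
  apply: (@le_trans _ _ (M * (e / (M + 1)))); first by rewrite ler_wpM2l// hd.
  by rewrite mulrCA ger_pMr// ler_pdivrMr// mul1r lerDl.
(* [eta] sees only the function f * h; if that vanishes identically, then [G] pairs to 0 with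
   [f]. *)
exists G => //; apply: H1_transfer hh iG _ => f hf fh.
rewrite -hG// /Lam (_ : conv f h = fun=> 0) ?(dualA0_0 heta)//.
by apply/funext => x; rewrite fh.
Qed.

(** The density is chosen separately for each representative [h], so linearity and compatibility
    with almost-everywhere equality must be recovered; both follow from [conv_determines], since
    [eta] fixes all pairings. *)
Lemma dual_operator : exists T : op R, bounded_op T /\ represents T eta.
Proof.
have /choice[T hT] h : exists G, H1 h ->
    H1 G /\ forall f, C0 f -> eta (conv f h) = conv f G 0.
  have [hh|hh] := pselect (H1 h); last by exists h.
  by have [G hG ?] := dual_density hh; exists G.
have T1 h : H1 h -> H1 (T h) by move=> /hT[].
have iT h : H1 h -> cintegrable (T h) by move=> /T1/H1_cintegrable.
have TE h f : H1 h -> C0 f -> conv f (T h) 0 = eta (conv f h).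
  by move=> /hT[_ h1] hf; rewrite h1.
have [M M0 hM] := dualA0_bound heta.
exists T; split; last first.
  by split=> // f h hf hh; rewrite pairE TE.
split=> //; split; [|split].
- move=> h h' hh hh' hae; apply: conv_determines; [exact: iT..|].
  move=> f hf; rewrite !TE// (@aeeq_conv _ f h h')//; exact: cintegrable_meas (H1_cintegrable _).
- move=> a h h' hh hh'; have ha : H1 (fun t => a * h t) by exact: H1Z.
  have ihh := H1_cintegrable hh; have ihh' := H1_cintegrable hh'.
  apply: conv_determines.
  + by apply: iT; exact: H1D.
  + by apply: cintegrableD; [apply: cintegrableZ|]; exact: iT.
  move=> f hf; rewrite convDr//; [|by apply: cintegrableZ; exact: iT|exact: iT].
  rewrite convZr//; last exact: iT.
  rewrite !TE//; last exact: H1D.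
  rewrite -heta.1; [|exact: A0_conv..].
  congr eta; apply/funext => x; rewrite convDr//; last exact: cintegrableZ.
  by rewrite convZr.
- exists M => h hh; apply: L1_duality; first exact: iT.
  move=> f A hf _ f1; rewrite TE//; apply: le_trans (dual_conv_le hM M0 hf hh) _.
  by rewrite ler_wpM2l// -[leRHS]mul1r ler_wpM2r ?L1norm_ge0// supnorm_le.
Qed.

Lemma represents_wstar_closure (T : op R) : represents T eta -> wstar_closure (@span_tau R) T.
Proof.
move=> hT m fs hs e had e0.
pose Fs i x := csum (fun k => conv (fs i k) (hs i k) x).
have hr i : (i < m)%N -> A0rep (Fs i) (fs i) (hs i) by move=> /had; exact: admissible_A0rep.
have hA i : (i < m)%N -> A0 (Fs i) by move=> im; exists (fs i), (hs i); exact: hr.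
(* The functions are reflected because pairing with [tau s] evaluates at - s. *)
have [|n [c [s hs_]]] := @point_evaluations_span C R 0 m
    (fun i x => Fs i (- x)) (fun i => eta (Fs i)).
  move=> a ha; rewrite -(dualA0_sum heta a hA) -[RHS](dualA0_0 heta).
  by congr eta; apply/funext => x; rewrite -[x]opprK ha.
exists (fun h t => \sum_(j < n) c j * tau (s j) h t); split; first by exists n, c, s.
move=> i im; rewrite (pairU_span _ _ _ (hr i im)) -(represents_pairU hT (hr i im)) -hs_//.
by rewrite subrr cabs0.
Qed.
End Surjectivity.

Theorem mainTheorem6 (R : realType) :
  (* (1) existence and uniqueness of eta_T *)
  (forall T : op R, PM T ->
     exists eta, represents T eta /\
       forall eta', represents T eta' -> A0eq eta' eta) /\
  (* (2) T |-> eta_T is linear ... *)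
  (forall (a : R[i]) (T T' : op R) eta eta', PM T -> PM T' ->
     represents T eta -> represents T' eta' ->
     represents (opcomb a T T') (fun F => a * eta F + eta' F)) /\
  (* ... isometric ... *)
  (forall (T : op R) eta, PM T -> represents T eta -> dualnorm eta = opnorm T) /\
  (* ... injective ... *)
  (forall (T T' : op R) eta, PM T -> PM T' ->
     represents T eta -> represents T' eta -> opeq T T') /\
  (* ... onto A_0(R)^* ... *)
  (forall eta, dualA0 eta -> exists T : op R, PM T /\ represents T eta) /\
  (* ... weak*-continuous ... *)
  (forall (T0 : op R) eta0, PM T0 -> represents T0 eta0 ->
     forall (m : nat) (Fs : nat -> R -> R[i]) (e : R),
       (forall i, (i < m)%N -> A0 (Fs i)) -> 0 < e ->
       exists (m' : nat) (fs hs : nat -> nat -> R -> R[i]) (d : R),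
         0 < d /\ (forall j, (j < m')%N -> admissible (fs j) (hs j)) /\
         forall (T : op R) eta, PM T -> represents T eta ->
           (forall j, (j < m')%N ->
              cabs (pairU T (fs j) (hs j) - pairU T0 (fs j) (hs j)) < d) ->
           forall i, (i < m)%N -> cabs (eta (Fs i) - eta0 (Fs i)) < e) /\
  (* ... with weak*-continuous inverse *)
  (forall (T0 : op R) eta0, PM T0 -> represents T0 eta0 ->
     forall (m : nat) (fs hs : nat -> nat -> R -> R[i]) (e : R),
       (forall j, (j < m)%N -> admissible (fs j) (hs j)) -> 0 < e ->
       exists (m' : nat) (Fs : nat -> R -> R[i]) (d : R),
         0 < d /\ (forall i, (i < m')%N -> A0 (Fs i)) /\
         forall (T : op R) eta, PM T -> represents T eta ->
           (forall i, (i < m')%N -> cabs (eta (Fs i) - eta0 (Fs i)) < d) ->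
           forall j, (j < m)%N ->
             cabs (pairU T (fs j) (hs j) - pairU T0 (fs j) (hs j)) < e).
Proof.
split; [|split; [|split; [|split; [|split; [|split]]]]].
- move=> T hT; exists (functional_of T); split; first exact: functional_of_represents.
  move=> eta' he' F [fs [hs hr]].
  by rewrite (represents_pairU he' hr) (functional_ofE hT.2 hr).
- by move=> a T T' eta eta' [bT _] [bT' _]; exact: represents_opcomb.
- move=> T eta hT he; apply/eqP; rewrite eq_le (dualnorm_le_opnorm hT he) /=.
  apply: ge_sup.
    exists (L1norm (T (fun=> 0))), (fun=> 0) => //; split; first exact: H1_0.
    by rewrite /L1norm /Rintegral (eq_integral (cst 0%E)) ?integral0// => t _ /=; rewrite cabs0.
  (* Lower bound: for [f] and [h] in the unit balls, [conv f h] lies in the unit ball of [A0], and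
     its image under [eta] is the pairing that tests the L^1 norm of [T h]. *)
  move=> _ [h [hh h1] <-]; apply: L1_duality; first exact: H1_cintegrable (hT.1.1 _ hh).
  move=> f A hf _ f1; rewrite -pairE -he.2//.
  apply: le_dualnorm; [exact: he.1|exact: A0_conv|].
  apply: le_trans (A0norm_conv hf hh) _.
  by rewrite mulr_ile1 ?supnorm_ge0 ?L1norm_ge0 ?supnorm_le.
- move=> T T' eta hT hT' he he' h hh.
  apply: conv_determines;
    [exact: H1_cintegrable (hT.1.1 _ hh)|exact: H1_cintegrable (hT'.1.1 _ hh)|].
  by move=> f hf; rewrite -!pairE -he.2// -he'.2.
- move=> eta he; have [T [bT hT]] := dual_operator he.
  by exists T; split=> //; split=> //; exact: represents_wstar_closure hT.
- move=> T0 eta0 _ he0 m Fs e hF e0.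
  have /choice[fs hfs] i : exists p : (nat -> R -> R[i]) * (nat -> R -> R[i]),
      (i < m)%N -> A0rep (Fs i) p.1 p.2.
    (* Beyond [m] any pair will do. *)
    have [im|im] := boolP (i < m)%N; last by exists (fun=> Fs i, fun=> Fs i).
    by have [fs [hs hr]] := hF i im; exists (fs, hs).
  (* Once a representation of each [Fs i] is fixed, [eta (Fs i)] equals [pairU T] on it, so the two
     neighbourhoods coincide and the same tolerance works; the inverse direction is identical. *)
  exists m, (fun i => (fs i).1), (fun i => (fs i).2), e; split=> //; split.
    by move=> j /hfs[].
  move=> T eta _ he h i im.
  by rewrite (represents_pairU he (hfs i im)) (represents_pairU he0 (hfs i im)); exact: h.
- move=> T0 eta0 _ he0 m fs hs e had e0.
  pose Fs i x := csum (fun k => Defs.conv (fs i k) (hs i k) x).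
  have hr i : (i < m)%N -> A0rep (Fs i) (fs i) (hs i) by move=> /had; exact: admissible_A0rep.
  exists m, Fs, e; split=> //; split.
    by move=> i im; exists (fs i), (hs i); exact: hr.
  move=> T eta _ he h i im.
  by rewrite -(represents_pairU he (hr i im)) -(represents_pairU he0 (hr i im)); exact: h.
Qed.
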